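(* Let $W$ be a $2m$-dimensional real linear symplectic space. For a given tuple $\{\rho_i\}_{i=1}^m$ of $m$ smooth functions on an interval $I$ there exists a rank $1$ curve $\Lambda:I\to L(W)$ of constant finite weight, unique up to a symplectic transformation of $W$, such that for any $1\le i\le m$ its $i$-th modified principal curvature $\lambda_i(t)$ coincides with $\rho_i(t)$.
   Context: $\sigma$ denotes the symplectic form of $W$. $L(W)$ is the Lagrange Grassmannian, i.e. the set (manifold) of all Lagrangian subspaces of $W$: $m$-dimensional subspaces $\Lambda\subset W$ with $\sigma|_\Lambda=0$. Curves are smooth. A basis $(E_1,\ldots,E_m,F_1,\ldots,F_m)$ of $W$ is called Darboux if $\sigma(E_i,E_j)=\sigma(F_i,F_j)=0$ and $\sigma(F_i,E_j)=\delta_{ij}$ for $1\le i,j\le m$. ''Unique up to a symplectic transformation'' means: if $\Lambda$ and $\tilde\Lambda$ are two such curves, there is a linear symplectic map $A:W\to W$ with $\tilde\Lambda(t)=A\Lambda(t)$ for all $t\in I$. Velocity: the tangent space $T_\Lambda L(W)$ is identified with the space of quadratic forms on $\Lambda$ (equivalently, self-adjoint linear maps $\Lambda\to\Lambda^*$). For a smooth curve $\Lambda(\cdot)$ in $L(W)$ and $l\in\Lambda(\tau)$, choose a smooth curve $l(\cdot)$ in $W$ with $l(t)\in\Lambda(t)$ for all $t$ and $l(\tau)=l$; then $\dot\Lambda(\tau)(l)=\sigma(l'(\tau),l)$, which depends only on $l$ and the velocity of the curve at $\tau$. Rank: $\Lambda(\cdot)$ is a rank $1$ curve if for every $t$ the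 velocity $\dot\Lambda(t)$ has rank $1$. Weight: given $\tau$, choose linear Darboux coordinates $W\cong\mathbb R^m\times\mathbb R^m$ such that $\Lambda(\tau)$ is transversal to the Lagrangian subspace $\{0\}\times\mathbb R^m$, so that for $t$ near $\tau$ one has $\Lambda(t)=\{(x,S_tx):x\in\mathbb R^m\}$ with $S_t$ a symmetric $m\times m$ matrix. The weight $k(\tau)$ at $\tau$ is the order of the zero at $t=\tau$ of $t\mapsto\det(S_t-S_\tau)$. The curve has constant finite weight if $k(\tau)$ is finite and the same for all $\tau\in I$. Modified principal curvatures: for a rank $1$ curve $\Lambda(\cdot)$ of constant finite weight there exists a moving Darboux frame $(E_1(t),\ldots,E_m(t),F_1(t),\ldots,F_m(t))$, unique up to simultaneous change of sign of all its vectors, such that $\Lambda(t)=\mathrm{span}(E_1(t),\ldots,E_m(t))$ and, for some functions $\lambda_1,\ldots,\lambda_m$, $$E_i'=E_{i+1}\ (1\le i\le m-1),\quad E_m'=\pm F_m,\quad F_1'=\lambda_mE_1,\quad F_i'=\lambda_{m-i+1}E_i-F_{i-1}\ (2\le i\le m),$$ with sign $+$ if the quadratic form $\dot\Lambda(t)$ is nonnegative definite and sign $-$ if it is nonpositive definite. The function $\lambda_i(t)$, well defined by the uniqueness of the frame, is called the $i$-th modified principal curvature of $\Lambda(\cdot)$.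
   Formalization: Uniqueness up to a symplectic transformation is stated among curves whose velocity has the same sign (nonnegative or nonpositive definite), since curves of opposite sign with equal curvatures are never symplectically equivalent; existence is proved for each sign. *)

(* Defs.v *)
From HB Require Import structures.
From mathcomp Require Import all_boot all_order all_algebra.
From mathcomp Require Import all_classical all_reals all_analysis.

Set Implicit Arguments.
Unset Strict Implicit.
Unset Printing Implicit Defensive.

Import Order.TTheory GRing.Theory Num.Theory numFieldNormedType.Exports.

Local Open Scope classical_set_scope.
Local Open Scope ring_scope.

Section Smoothness.
Variable R : realType.

(* Derivatives are taken relative to a domain [D] (in practice a nondegenerate
   interval), hence are one-sided at the end points of [D] lying in [D]. *)
Definition has_deriv (D : set R) (f : R -> R) (t l : R) : Prop :=
  (f s - f t) / (s - t) @[s --> within D t^'] --> l.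

Definition derivatives (D : set R) (f : R -> R) (G : nat -> R -> R) : Prop :=
  (forall t, D t -> G 0 t = f t) /\
  (forall n t, D t -> has_deriv D (G n) t (G n.+1 t)).

Definition smooth_on (D : set R) (f : R -> R) : Prop :=
  exists G, derivatives D f G.

(* [f], defined on [D] near [t0], vanishes at [t0] exactly to order [k]. *)
Definition zero_order (D : set R) (f : R -> R) (t0 : R) (k : nat) : Prop :=
  exists2 e : R, 0 < e &
    exists G, [/\ derivatives (D `&` ball t0 e) f G,
                  (forall j, (j < k)%N -> G j t0 = 0) & G k t0 != 0].

(* A finite-dimensional [W] carries no canonical norm in the library;
   differentiation of [W]-valued maps is tested on all linear forms, which
   amounts to differentiating the coordinates in any basis. *)
Definition has_vderiv (W : vectType R) (D : set R) (w : R -> W) (t : R)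
    (v : W) : Prop :=
  forall phi : {scalar W}, has_deriv D (fun s => phi (w s)) t (phi v).

Definition vsmooth_on (W : vectType R) (D : set R) (w : R -> W) : Prop :=
  forall phi : {scalar W}, smooth_on D (fun s => phi (w s)).

End Smoothness.

Section QuadraticForms.
Variables (R : realType) (W : vectType R).

Definition polar (Q : W -> R) (u v : W) : R := (Q (u + v) - Q u - Q v) / 2.

Definition qf_rank (U : {vspace W}) (Q : W -> R) : nat :=
  \rank (\matrix_(i < \dim U, j < \dim U)
           polar Q (vbasis U)`_i (vbasis U)`_j).

End QuadraticForms.

Section LagrangeGrassmannian.
Variables (R : realType) (m : nat) (W : vectType R).
Variable sigma : {skew_symmetric W}.

Definition lagrangian (L : {vspace W}) : Prop :=
  \dim L = m /\ (forall u v, u \in L -> v \in L -> sigma u v = 0).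

Definition darboux (E F : 'I_m -> W) : Prop :=
  [/\ basis_of {:W}%VS (codom E ++ codom F),
      (forall i j, sigma (E i) (E j) = 0),
      (forall i j, sigma (F i) (F j) = 0) &
      (forall i j, sigma (F i) (E j) = (i == j)%:R)].

Definition of_coords (E F : 'I_m -> W) (x y : 'cV[R]_m) : W :=
  \sum_i x i 0 *: E i + \sum_i y i 0 *: F i.

(* The identification of [W] with R^m x R^m by the Darboux basis [(E, F)] puts
   [L t0] in the domain of a standard chart of the Lagrange Grassmannian (the
   subspaces transversal to 0 x R^m), and [S t] is the symmetric matrix
   representing [L t] in this chart for [t] in [I] near [t0]. *)
Definition in_chart (I : set R) (L : R -> {vspace W}) (t0 : R)
    (E F : 'I_m -> W) (S : R -> 'M[R]_m) : Prop :=
  [/\ darboux E F,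
      (L t0 :&: <<codom F>>)%VS = 0%VS &
      \forall t \near within I (nbhs t0),
        (S t)^T = S t /\
        (forall w, w \in L t <->
           exists x : 'cV[R]_m, w = of_coords E F x (S t *m x))].

Definition smooth_curve (I : set R) (L : R -> {vspace W}) : Prop :=
  (forall t, I t -> lagrangian (L t)) /\
  (forall t0, I t0 -> exists E F S, in_chart I L t0 E F S /\
     exists2 e : R, 0 < e &
       forall i j, smooth_on (I `&` ball t0 e) (fun t => S t i j)).

Definition velocity (I : set R) (L : R -> {vspace W}) (t0 : R) (l : W) : R :=
  xget 0 [set q | exists w w', [/\ vsmooth_on I w,
                                   (forall t, I t -> w t \in L t),
                                   w t0 = l,
                                   has_vderiv I w t0 w' &
                                   q = sigma w' l]].

Definition rank1_curve (I : set R) (L : R -> {vspace W}) : Prop :=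
  smooth_curve I L /\
  (forall t, I t -> qf_rank (L t) (velocity I L t) = 1%N).

Definition weight (I : set R) (L : R -> {vspace W}) (t0 : R) (k : nat) : Prop :=
  exists E F S, in_chart I L t0 E F S /\
    zero_order I (fun t => \det (S t - S t0)) t0 k.

Definition constant_finite_weight (I : set R) (L : R -> {vspace W}) : Prop :=
  exists k, forall t, I t -> weight I L t k.

(* Nonnegative definite velocities for [b = false], nonpositive definite ones
   for [b = true].  The sign is a symplectic invariant of a rank 1 curve that
   the modified principal curvatures do not record: both signs occur for every
   tuple of curvatures. *)
Definition velocity_sign (b : bool) (I : set R) (L : R -> {vspace W}) : Prop :=
  forall t l, I t -> l \in L t -> 0 <= (-1) ^+ b * velocity I L t l.

(* Indices start at 0, so [lam i] is the function lambda_(i+1), and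
   [rev_ord i] turns lambda_(m-i+1) into [lam (rev_ord i)]. *)
Definition normal_frame (I : set R) (L : R -> {vspace W})
    (E F : 'I_m -> R -> W) (lam : 'I_m -> R -> R) : Prop :=
  [/\ (forall i, vsmooth_on I (E i)) /\ (forall i, vsmooth_on I (F i)),
      (forall t, I t -> darboux (E ^~ t) (F ^~ t)),
      (forall t, I t -> L t = <<codom (E ^~ t)>>%VS) &
      exists2 b : bool, velocity_sign b I L &
        forall t, I t ->
        [/\ (forall i j : 'I_m, j = i.+1 :> nat ->
               has_vderiv I (E i) t (E j t)),
            (forall i : 'I_m, i.+1 = m ->
               has_vderiv I (E i) t ((-1) ^+ b *: F i t)),
            (forall i : 'I_m, i = 0%N :> nat ->
               has_vderiv I (F i) t (lam (rev_ord i) t *: E i t)) &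
            (forall i j : 'I_m, i = j.+1 :> nat ->
               has_vderiv I (F i) t (lam (rev_ord i) t *: E i t - F j t))]].

(* [f] is the [i]-th curvature function: the common value, over all normal
   frames of the curve (there being one), of [lam i]. *)
Definition modified_curvature (I : set R) (L : R -> {vspace W}) (i : 'I_m)
    (f : R -> R) : Prop :=
  (exists E F lam, normal_frame I L E F lam) /\
  (forall E F lam, normal_frame I L E F lam -> forall t, I t -> lam i t = f t).

End LagrangeGrassmannian.

(* Main.v *)
Require Import Defs.
From HB Require Import structures.
From mathcomp Require Import all_boot all_order all_algebra.
From mathcomp Require Import all_classical all_reals all_analysis.
From mathcomp Require Import ring lra zify.

Set Implicit Arguments.
Unset Strict Implicit.
Unset Printing Implicit Defensive.

Import Order.TTheory GRing.Theory Num.Theory numFieldNormedType.Exports.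

Local Open Scope classical_set_scope.
Local Open Scope ring_scope.

(** A curve together with a normal frame [(E, F)] is the same thing as a
    solution of the structure equations, a linear differential system whose
    coefficients are the curvatures. All three parts of the theorem rest on
    this.

    Existence. Linear systems with smooth coefficients have smooth solutions on
    the whole of any interval [I] (ode_exists, ode_solution_smooth). Start from
    a Darboux basis of [W] (darboux_exists) and solve. The matrix of the system
    is infinitesimally symplectic, so the solution stays a Darboux basis
    (structure_equations_symplectic), and [L t] is the span of the [E i t]. Its
    velocity is plus or minus the square of the linear form [sigma (F m) _]
    (frame_velocity), because only [E m] leaves [L] to first order; so the
    curve has rank 1 and the prescribed sign.

    Weight. In the chart given by the frame at [t0] the curve is the graph of a
    matrix whose determinant is, up to a factor tending to [1], that of the
    components [Q i j] of [E i t] along [F j t0]. Along the chain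
    [E 1, ..., E m, F m, ..., F 1] each vector is essentially the derivative of
    the one before, so [Q i j] is equivalent to plus or minus
    [(t - t0) ^ (2m + 1 - i - j) / (2m + 1 - i - j)!], the sign depending only
    on [j] (chain_asymptotics). The powers factor out of the determinant with
    total exponent [m ^ 2], and the remaining determinant of inverse factorials
    is not zero (det_inv_factorial_neq0). So the weight is [m ^ 2] at every
    point (frame_weight).

    The curvatures are those of every normal frame. For two normal frames of
    the same curve, [E'_k] for [k < m] has its derivative in [L], which forces
    [E'_1] to be a multiple of [E_1]; comparing velocities, the factor is a
    sign, with zero derivative. Differentiating repeatedly, [E'_k] and [F'_k]
    are the same multiple of [E_k] and [F_k], and the curvatures agree
    (structured_frame_curvature).

    Uniqueness. Two curves with the same curvatures have normal frames solving
    the same linear system. The linear map carrying one frame to the other at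
    one point is symplectic and carries it at every point, as solutions of
    linear systems are determined by a value (structured_frame_congruence). *)

(** * Derivatives relative to a domain *)

Section RelativeDerivative.
Variable R : realType.
Implicit Types (D : set R) (f g : R -> R) (t l : R).

Lemma near_dnbhsP D t (P : R -> Prop) :
  (\forall s \near within D t^', P s) <->
  (exists2 d, 0 < d & forall s, D s -> `|s - t| < d -> s != t -> P s).
Proof.
split.
  rewrite /within /= /dnbhs /within /= => /nbhs_ballP[d d0 H].
  exists d => // s Ds sd st; apply: H => //.
  by rewrite -ball_normE /= distrC.
move=> [d d0 H]; rewrite /within /= /dnbhs /within /=.
apply/nbhs_ballP; exists d => // s; rewrite -ball_normE /= distrC => sd st Ds.
exact: H.
Qed.

Lemma near_nbhsP D t (P : R -> Prop) :
  (\forall s \near within D (nbhs t), P s) <->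
  (exists2 d, 0 < d & forall s, D s -> `|s - t| < d -> P s).
Proof.
split.
  rewrite /within /= => /nbhs_ballP[d d0 H].
  exists d => // s Ds sd; apply: H => //.
  by rewrite -ball_normE /= distrC.
move=> [d d0 H]; rewrite /within /=.
apply/nbhs_ballP; exists d => // s; rewrite -ball_normE /= distrC => sd Ds.
exact: H.
Qed.

Lemma has_deriv_ext D f g t l : (forall s, D s -> f s = g s) -> D t ->
  has_deriv D f t l -> has_deriv D g t l.
Proof.
move=> fg Dt; apply: cvg_trans; apply: near_eq_cvg.
by apply/near_dnbhsP; exists 1 => // s Ds _ _; rewrite !fg.
Qed.

Lemma has_deriv_subset D D' f t l : D' `<=` D ->
  has_deriv D f t l -> has_deriv D' f t l.
Proof.
move=> sub; apply: cvg_trans; apply: cvg_app => P.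
move=> /near_dnbhsP[d d0 H]; apply/near_dnbhsP; exists d => // s /sub; exact: H.
Qed.

Lemma has_deriv_local D D' f t l d : 0 < d ->
  (forall s, D s -> `|s - t| < d -> D' s) ->
  has_deriv D' f t l -> has_deriv D f t l.
Proof.
move=> d0 sub; apply: cvg_trans; apply: cvg_app => P.
move=> /near_dnbhsP[d' d'0 H]; apply/near_dnbhsP.
exists (Num.min d d'); first by rewrite lt_min d0.
by move=> s Ds; rewrite lt_min => /andP[sd sd']; apply: H => //; exact: sub.
Qed.

Lemma has_deriv_cvg D f t l : has_deriv D f t l ->
  f s @[s --> within D t^'] --> f t.
Proof.
move=> H.
have Hs : (s - t) @[s --> within D t^'] --> 0.
  apply/cvgrPdist_lt => e e0; apply/near_dnbhsP; exists e => // s _ se _.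
  by rewrite sub0r normrN.
have : (f s - f t) / (s - t) * (s - t) + f t @[s --> within D t^'] -->
    l * 0 + f t by apply: cvgD; [exact: cvgM | exact: cvg_cst].
rewrite mulr0 add0r; apply: cvg_trans; apply: near_eq_cvg.
apply/near_dnbhsP; exists 1 => // s _ _ st /=.
by rewrite divfK ?subrK // subr_eq0.
Qed.

Lemma has_deriv_continuous D f (f' : R -> R) :
  (forall t, D t -> has_deriv D f t (f' t)) -> {within D, continuous f}.
Proof.
move=> H; apply/subspace_continuousP => t Dt.
have /has_deriv_cvg/cvgrPdist_lt C := H t Dt.
apply/cvgrPdist_lt => e e0.
have /near_dnbhsP[d d0 K] := C e e0.
apply/near_nbhsP; exists d => // s Ds sd.
by have [->|st] := eqVneq s t; [rewrite subrr normr0|exact: K].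
Qed.

Lemma continuous_cvg_dnbhs D f t : {within D, continuous f} -> D t ->
  f s @[s --> within D t^'] --> f t.
Proof.
move=> /subspace_continuousP cf Dt; have := cf t Dt.
apply: cvg_trans; apply: cvg_app => P /near_nbhsP[d d0 H].
by apply/near_dnbhsP; exists d => // s Ds sd _; exact: H.
Qed.

Lemma has_deriv_cst D (c : R) t : has_deriv D (cst c) t 0.
Proof.
apply/cvgrPdist_lt => e e0; apply/near_dnbhsP; exists 1 => // s _ _ _.
by rewrite subrr mul0r subrr normr0.
Qed.

Lemma has_deriv_id D t : has_deriv D id t 1.
Proof.
apply/cvgrPdist_lt => e e0; apply/near_dnbhsP; exists 1 => // s _ _ st.
by rewrite divff ?subr_eq0 // subrr normr0.
Qed.

Lemma has_derivD D f g t l k : has_deriv D f t l -> has_deriv D g t k ->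
  has_deriv D (fun s => f s + g s) t (l + k).
Proof.
move=> Hf Hg.
have : (f s - f t) / (s - t) + (g s - g t) / (s - t) @[s --> within D t^'] -->
    l + k by exact: cvgD.
apply: cvg_trans; apply: near_eq_cvg.
by apply/near_dnbhsP; exists 1 => // s _ _ st /=; rewrite -mulrDl;
  congr (_ / _); ring.
Qed.

Lemma has_derivM D f g t l k : has_deriv D f t l -> has_deriv D g t k ->
  has_deriv D (fun s => f s * g s) t (l * g t + f t * k).
Proof.
move=> Hf Hg.
have : (f s - f t) / (s - t) * g s + f t * ((g s - g t) / (s - t))
    @[s --> within D t^'] --> l * g t + f t * k.
  apply: cvgD; apply: cvgM => //; [exact: has_deriv_cvg Hg | exact: cvg_cst].
apply: cvg_trans; apply: near_eq_cvg.
apply/near_dnbhsP; exists 1 => // s _ _ st /=.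
have : s - t != 0 by rewrite subr_eq0.
by move=> ?; field.
Qed.

Lemma has_derivZ D (c : R) f t l : has_deriv D f t l ->
  has_deriv D (fun s => c * f s) t (c * l).
Proof.
by move=> Hf; have := has_derivM (has_deriv_cst D c t) Hf; rewrite mul0r add0r.
Qed.

Lemma has_derivN D f t l : has_deriv D f t l ->
  has_deriv D (fun s => - f s) t (- l).
Proof.
move=> /(has_derivZ (c := -1)); rewrite mulN1r.
by under eq_fun do rewrite mulN1r.
Qed.

Lemma has_derivB D f g t l k : has_deriv D f t l -> has_deriv D g t k ->
  has_deriv D (fun s => f s - g s) t (l - k).
Proof. by move=> Hf /has_derivN; exact: has_derivD. Qed.

Lemma has_deriv_sum D (J : Type) (r : seq J) (f : J -> R -> R) (l : J -> R) t :
  (forall j, has_deriv D (f j) t (l j)) ->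
  has_deriv D (fun s => \sum_(j <- r) f j s) t (\sum_(j <- r) l j).
Proof.
move=> H; elim: r => [|j r IH].
  rewrite big_nil; under eq_fun do rewrite big_nil; exact: has_deriv_cst.
by rewrite big_cons; under eq_fun do rewrite big_cons; exact: has_derivD.
Qed.

Lemma has_derivV D f t l : f t != 0 -> has_deriv D f t l ->
  has_deriv D (fun s => (f s)^-1) t (- l / f t ^+ 2).
Proof.
move=> f0 Hf; have Hc := has_deriv_cvg Hf.
have : - ((f s - f t) / (s - t)) * (f s)^-1 * (f t)^-1 @[s --> within D t^'] -->
    - l * (f t)^-1 * (f t)^-1.
  by apply: cvgM; [apply: cvgM; [exact: cvgN | exact: cvgV] | exact: cvg_cst].
rewrite -mulrA -invfM -expr2; apply: cvg_trans; apply: near_eq_cvg.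
have /cvgrPdist_lt/(_ _ (_ : 0 < `|f t|))/near_dnbhsP[|d d0 H] := Hc.
  by rewrite normr_gt0.
apply/near_dnbhsP; exists d => // s Ds sd st /=.
have fs0 : f s != 0.
  apply/eqP => fs0; have := H s Ds sd st.
  by rewrite fs0 subr0 ltxx.
have : s - t != 0 by rewrite subr_eq0.
by move=> st0; field; rewrite st0 fs0 f0.
Qed.

Lemma has_derivX D f t l n : has_deriv D f t l ->
  has_deriv D (fun s => f s ^+ n.+1) t (n.+1%:R * f t ^+ n * l).
Proof.
move=> df; elim: n => [|n IH].
  by rewrite expr0 mulr1 mul1r; under eq_fun do rewrite expr1.
under eq_fun do rewrite exprS.
rewrite -(natr1 n.+1); have := has_derivM df IH; congr has_deriv.
by rewrite !exprS; ring.
Qed.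

Lemma is_derive_has_deriv D f t l : is_derive t 1 f l -> has_deriv D f t l.
Proof.
move=> /is_derive1_caratheodory[g [gE gc <-]].
have : g s @[s --> within D t^'] --> g t.
  apply/cvgrPdist_lt => e e0.
  have /cvgrPdist_lt/(_ _ e0)/nbhs_ballP[d d0 H] := gc.
  apply/near_dnbhsP; exists d => // s _ sd _; apply: H.
  by rewrite -ball_normE /= distrC.
apply: cvg_trans; apply: near_eq_cvg; apply/near_dnbhsP;
  exists 1 => // s _ _ st.
by rewrite gE mulfK // subr_eq0.
Qed.

Lemma has_deriv_is_derive D f t l : nbhs t D -> has_deriv D f t l ->
  is_derive t 1 f l.
Proof.
move=> /nbhs_ballP[r r0 tD] H; apply/is_derive1_caratheodory.
exists (fun s => if s == t then l else (f s - f t) / (s - t)); split.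
- move=> z; case: eqVneq => [->|zt]; first by rewrite !subrr mulr0.
  by rewrite divfK // subr_eq0.
- apply/cvgrPdist_lt => e e0; rewrite eqxx.
  have /cvgrPdist_lt/(_ _ e0)/near_dnbhsP[d d0 K] := H.
  apply/nbhs_ballP; exists (Num.min d r); first by rewrite /= lt_min d0.
  move=> s; rewrite /= distrC lt_min => /andP[sd sr].
  case: eqVneq => [_|st]; first by rewrite subrr normr0.
  by apply: K => //; apply: (tD s); rewrite -ball_normE /= distrC.
- by rewrite eqxx.
Qed.

End RelativeDerivative.

(** * The mean value theorem and its consequences *)

Section MeanValue.
Variable R : realType.
Implicit Types (D : set R) (f g : R -> R) (t l : R).

Lemma has_deriv_MVT D f f' (a b : R) : is_interval D -> D a -> D b -> a < b ->
  (forall t, D t -> has_deriv D f t (f' t)) ->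
  exists2 c, a < c < b & f b - f a = f' c * (b - a).
Proof.
move=> iD Da Db ab df.
have sub s : a <= s <= b -> D s by apply: iD.
have [||c] := @MVT R f f' a b ab.
- move=> s; rewrite in_itv /= => /andP[as_ sb].
  have Ds : D s by apply: sub; rewrite !ltW.
  apply: has_deriv_is_derive (df _ Ds).
  have : \forall u \near s, u \in `]a,
    b[ by apply: near_in_itvoo; rewrite in_itv /= as_ sb.
  apply: filterS => u /=; rewrite in_itv /= => /andP[au ub].
  by apply: sub; rewrite !ltW.
- apply: (@continuous_subspaceW _ _ _ D).
    by move=> s /=; rewrite in_itv /=; exact: sub.
  exact: has_deriv_continuous df.
by rewrite in_itv /= => cab E; exists c.
Qed.

(** Rolle's theorem for [(f t - f t0) * g - (g t - g t0) * f]. That [c] lies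
    strictly between [t0] and [t], whichever is the larger, is recorded by a
    sign and a distance, so that no use has to split on their order. *)
Lemma has_deriv_cauchy_MVT D f f' g g' (t0 t : R) : is_interval D ->
  D t0 -> D t -> t != t0 ->
  (forall s, D s -> has_deriv D f s (f' s)) ->
  (forall s, D s -> has_deriv D g s (g' s)) ->
  exists c, [/\ D c, 0 < (c - t0) * (t - t0), `|c - t0| < `|t - t0| &
    (f t - f t0) * g' c = (g t - g t0) * f' c].
Proof.
move=> iD Dt0 Dt tt0 df dg.
pose h s := (f t - f t0) * g s - (g t - g t0) * f s.
have dh s : D s ->
    has_deriv D h s ((f t - f t0) * g' s - (g t - g t0) * f' s).
  by move=> Ds; apply: has_derivB; apply: has_derivZ; auto.
have ht : h t = h t0 by rewrite /h; ring.
have [lt|lt] : t0 < t \/ t < t0.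
  by move: tt0; rewrite neq_lt => /orP[|]; [right|left].
- have [c /andP[ac cb] /eqP] := has_deriv_MVT iD Dt0 Dt lt dh.
  rewrite ht subrr eq_sym mulf_eq0 !subr_eq0 (gt_eqF lt) orbF => /eqP E.
  exists c; split => //; first by apply: (iD _ _ Dt0 Dt); rewrite !ltW.
  + by rewrite mulr_gt0 // subr_gt0.
  + by rewrite !gtr0_norm ?subr_gt0 // ltrD2r.
- have [c /andP[ac cb] /eqP] := has_deriv_MVT iD Dt Dt0 lt dh.
  rewrite ht subrr eq_sym mulf_eq0 !subr_eq0 (gt_eqF lt) orbF => /eqP E.
  exists c; split => //; first by apply: (iD _ _ Dt Dt0); rewrite !ltW.
  + by rewrite nmulr_lgt0 subr_lt0.
  + by rewrite !ltr0_norm ?subr_lt0 // ltrN2 ltrD2r.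
Qed.

Lemma has_deriv0_cst D f (t0 t : R) : is_interval D -> D t0 -> D t ->
  (forall s, D s -> has_deriv D f s 0) -> f t = f t0.
Proof.
move=> iD Dt0 Dt df; have [->//|tt0] := eqVneq t t0.
have [c [_ _ _]] := has_deriv_cauchy_MVT iD Dt0 Dt tt0 df
  (fun s _ => has_deriv_id D s).
by rewrite mulr1 mulr0 => /eqP; rewrite subr_eq0 => /eqP.
Qed.

Lemma interval_limit_point D t : is_interval D ->
  (exists a b, [/\ D a, D b & a < b]) -> D t -> ProperFilter (within D t^').
Proof.
move=> iD [a [b [Da Db ab]]] Dt.
have [c Dc ct] : exists2 c, D c & c != t.
  by have [at_|?] := eqVneq a t; [exists b => //; rewrite -at_ gt_eqF|exists a].
split; last exact: within_filter.
move=> /near_dnbhsP[d d0 H].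
have ct0 : 0 < `|c - t| by rewrite normr_gt0 subr_eq0.
pose th := d / (d + `|c - t|).
have dn : 0 < d + `|c - t| by rewrite addr_gt0.
have th0 : 0 < th by rewrite divr_gt0.
have th1 : th < 1 by rewrite ltr_pdivrMr // mul1r ltrDl.
have sE : t + (c - t) * th - t = (c - t) * th by rewrite addrC addKr.
apply: (H (t + (c - t) * th)).
- have [tc|ct'] : t < c \/ c < t.
    by move: ct; rewrite neq_lt => /orP[|]; [right|left].
  + apply: (iD _ _ Dt Dc); apply/andP; split; first by nra.
    by have : (c - t) * (1 - th) > 0; [apply: mulr_gt0; lra | lra].
  + apply: (iD _ _ Dc Dt); apply/andP; split; last by nra.
    by have : (t - c) * (1 - th) > 0; [apply: mulr_gt0; lra | lra].
- rewrite sE normrM (gtr0_norm th0) /th mulrA ltr_pdivrMr // mulrC ltr_pM2l //.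
  by rewrite ltrDr.
- by rewrite -subr_eq0 sE mulf_neq0 ?subr_eq0 // gt_eqF.
Qed.

Lemma has_deriv_unique D f t l k : ProperFilter (within D t^') ->
  has_deriv D f t l -> has_deriv D f t k -> l = k.
Proof. by move=> PF; apply: cvg_unique. Qed.

(** L'Hopital's rule. By Cauchy's mean value theorem with
    [g t = (t - t0) ^+ n.+1], the quotient at [t] is
    [f' / (n.+1%:R * (t - t0) ^+ n)] at a point closer to [t0]; at an end point
    of the domain the limits are one-sided. *)
Lemma has_deriv_lhopital D f f' (t0 c : R) n : is_interval D -> D t0 ->
  f t0 = 0 -> (forall t, D t -> has_deriv D f t (f' t)) ->
  f' t / (t - t0) ^+ n @[t --> within D t0^'] --> c ->
  f t / (t - t0) ^+ n.+1 @[t --> within D t0^'] --> c / n.+1%:R.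
Proof.
move=> iD Dt0 f0 df /cvgrPdist_lt C; apply/cvgrPdist_lt => e e0.
have /near_dnbhsP[d d0 H] := C e e0.
apply/near_dnbhsP; exists d => // t Dt td tt0.
pose p s := (s - t0) ^+ n.+1.
have dp s : D s -> has_deriv D p s (n.+1%:R * (s - t0) ^+ n).
  move=> _; have := has_derivX (n := n)
    (has_derivB (has_deriv_id D s) (has_deriv_cst D t0 s)).
  by rewrite subr0 mulr1.
have [c' [Dc' cp cd E]] := has_deriv_cauchy_MVT iD Dt0 Dt tt0 df dp.
have c't0 : c' - t0 != 0.
  by apply: contraTneq cp => ->; rewrite mul0r ltxx.
have := H c' Dc' (lt_trans cd td); rewrite -subr_eq0 => /(_ c't0) H1.
move: E; rewrite f0 /p subrr expr0n subr0 /= => E.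
have tt0' : t - t0 != 0 by rewrite subr_eq0.
have n0 : n.+1%:R != 0 :> R by rewrite pnatr_eq0.
have -> : f t / (t - t0) ^+ n.+1 = f' c' / (c' - t0) ^+ n / n.+1%:R.
  apply: (@mulIf _ (n.+1%:R * (c' - t0) ^+ n * (t - t0) ^+ n.+1)).
    by rewrite !mulf_neq0 ?expf_neq0.
  transitivity (f t * (n.+1%:R * (c' - t0) ^+ n)).
    by field; rewrite expf_neq0.
  by rewrite E subr0; field; rewrite nat1r n0 expf_neq0.
rewrite -mulrBl normrM [X in _ * X]gtr0_norm ?invr_gt0 ?ltr0n //.
rewrite ltr_pdivrMr ?ltr0n //; apply: lt_le_trans H1 _.
by rewrite ler_peMr ?ler1n // ltW.
Qed.

(** A Taylor expansion read backwards. As long as the derivatives of order less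
    than [j] vanish at [t0], L'Hopital's rule gives
    [f / (t - t0) ^+ j --> G j t0 / j!]; for [j < K] that limit is [0]. *)
Lemma derivatives_zero_order D f G (t0 c : R) K : is_interval D ->
  ProperFilter (within D t0^') -> D t0 -> derivatives D f G ->
  f t / (t - t0) ^+ K @[t --> within D t0^'] --> c -> c != 0 ->
  (forall j, (j < K)%N -> G j t0 = 0) /\ G K t0 != 0.
Proof.
move=> iD PF Dt0 [G0 dG] fc c0.
have taylor n k : (forall i, (i < n)%N -> G (k + i)%N t0 = 0) ->
    G k t / (t - t0) ^+ n @[t --> within D t0^'] --> G (k + n)%N t0 / n`!%:R.
  elim: n k => [|n IH] k Gk0.
    rewrite addn0 fact0 divr1; have := has_deriv_cvg (dG k t0 Dt0).
    apply: cvg_trans; apply: near_eq_cvg.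
    by apply/near_dnbhsP; exists 1 => // s _ _ _; rewrite expr0 divr1.
  rewrite factS mulnC natrM invfM mulrA -addSnnS;
    apply: (has_deriv_lhopital iD Dt0).
  - by have := Gk0 0%N isT; rewrite addn0.
  - exact: dG.
  - by apply: IH => i ltin; rewrite addSnnS; apply: Gk0.
have fG n : (forall i, (i < n)%N -> G i t0 = 0) ->
    f t / (t - t0) ^+ n @[t --> within D t0^'] --> G n t0 / n`!%:R.
  move=> /(taylor n 0); apply: cvg_trans; apply: near_eq_cvg.
  by apply/near_dnbhsP; exists 1 => // s Ds _ _; rewrite G0.
have fact_neq0 n : n`!%:R != 0 :> R by rewrite pnatr_eq0 -lt0n fact_gt0.
have vanish j : (j < K)%N -> G j t0 = 0.
  have [n] := ubnP j; elim: n j => // n IH j ltjn ltjK.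
  have Cj : f t / (t - t0) ^+ j @[t --> within D t0^'] --> G j t0 / j`!%:R.
    by apply: fG => i ltij; apply: IH; [lia|lia].
  have Hs : (s - t0) ^+ (K - j) @[s --> within D t0^'] --> (0 : R).
    have := has_deriv_cvg (has_derivX (n := K - j.+1)
      (has_derivB (has_deriv_id D t0) (has_deriv_cst D t0 t0))).
    by rewrite subnSK // subrr expr0n subn_eq0 leqNgt ltjK.
  have Dj : f t / (t - t0) ^+ j @[t --> within D t0^'] --> c * 0.
    have : f t / (t - t0) ^+ K * (t - t0) ^+ (K - j) @[t --> within D t0^'] -->
      c * 0.
      exact: cvgM.
    apply: cvg_trans; apply: near_eq_cvg.
    apply/near_dnbhsP; exists 1 => // s _ _ st.
    have st0 : s - t0 != 0 by rewrite subr_eq0.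
    rewrite /= -{1}(subnK (ltnW ltjK)) exprD; field.
    by rewrite !expf_neq0.
  have E : G j t0 / j`!%:R = c * 0 by exact: (cvg_unique (T := R) _ Cj Dj).
  by move/eqP: E; rewrite mulr0 mulf_eq0 invr_eq0 (negPf (fact_neq0 j)) orbF =>
    /eqP.
split => //; apply: contra_neq c0 => GK.
have CK := fG K vanish.
have -> : c = G K t0 / K`!%:R by exact: (cvg_unique (T := R) _ fc CK).
by rewrite GK mul0r.
Qed.

End MeanValue.

(** * Smooth functions on a domain *)

Section Smooth.
Variable R : realType.
Implicit Types (D : set R) (f g : R -> R) (t l : R).

(** Smoothness is a coinductive notion: a class of functions in which every
    function has a derivative in the class consists of smooth functions. Each
    closure property below amounts to naming such a class, with no formula for
    the higher derivatives. *)
Lemma smooth_coinduction D (P : (R -> R) -> Prop) :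
  (forall f, P f -> exists2 g, P g & forall t, D t -> has_deriv D f t (g t)) ->
  forall f, P f -> smooth_on D f.
Proof.
move=> H f Pf.
have /choice[next nextP] : forall f, exists g, P f ->
    P g /\ forall t, D t -> has_deriv D f t (g t).
  move=> h; have [Ph|nPh] := pselect (P h); last by exists h.
  by have [g Pg dg] := H h Ph; exists g.
have PG n : P (iter n next f) by elim: n => //= n /nextP[].
exists (fun n => iter n next f); split => // n t Dt.
by have [_] := nextP _ (PG n); apply.
Qed.

Lemma smooth_has_deriv D f : smooth_on D f ->
  exists2 g, smooth_on D g & forall t, D t -> has_deriv D f t (g t).
Proof.
move=> [G [G0 dG]]; exists (G 1%N); first by exists (fun n => G n.+1);
  split => [t _ //|n]; exact: dG.
by move=> t Dt; apply: (has_deriv_ext G0 Dt); exact: dG.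
Qed.

Lemma smooth_has_deriv_fam D (J : Type) (f : J -> R -> R) :
  (forall j, smooth_on D (f j)) ->
  exists g : J -> R -> R, (forall j, smooth_on D (g j)) /\
    forall j t, D t -> has_deriv D (f j) t (g j t).
Proof.
move=> sf; have /choice[g gP] : forall j, exists g, smooth_on D g /\
    forall t, D t -> has_deriv D (f j) t (g t).
  by move=> j; have [g] := smooth_has_deriv (sf j); exists g.
by exists g; split => j; have [] := gP j.
Qed.

Lemma smooth_ext D f g : (forall t, D t -> f t = g t) -> smooth_on D f ->
  smooth_on D g.
Proof.
by move=> fg [G [G0 dG]]; exists G; split => // t Dt; rewrite G0 // fg.
Qed.

Lemma smooth_subset D D' f : D' `<=` D -> smooth_on D f -> smooth_on D' f.
Proof.
move=> sub [G [G0 dG]]; exists G; split => [t /sub/G0 //|n t D't].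
by apply: (has_deriv_subset sub); apply/dG/sub.
Qed.

Lemma smooth_continuous D f : smooth_on D f -> {within D, continuous f}.
Proof. by move=> /smooth_has_deriv[g _]; exact: has_deriv_continuous. Qed.

Lemma smooth_cst D (c : R) : smooth_on D (cst c).
Proof.
exists (fun n => if n is 0 then cst c else cst 0); split => // -[|n] t _;
  exact: has_deriv_cst.
Qed.

Lemma smoothD D f g : smooth_on D f -> smooth_on D g ->
  smooth_on D (fun t => f t + g t).
Proof.
move=> [G [G0 dG]] [H [H0 dH]]; exists (fun n t => G n t + H n t); split.
  by move=> t Dt; rewrite G0 ?H0.
by move=> n t Dt; apply: has_derivD; [exact: dG|exact: dH].
Qed.

Lemma smooth_sum D (J : Type) (r : seq J) (f : J -> R -> R) :
  (forall j, smooth_on D (f j)) -> smooth_on D (fun t => \sum_(j <- r) f j t).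
Proof.
move=> sf; elim: r => [|j r IH].
  by under eq_fun do rewrite big_nil; exact: smooth_cst.
by under eq_fun do rewrite big_cons; exact: smoothD.
Qed.

(** A product need not have a product as derivative, but the finite sums of
    products are stable under differentiation. *)
Lemma smoothM D f g : smooth_on D f -> smooth_on D g ->
  smooth_on D (fun t => f t * g t).
Proof.
move=> sf sg.
pose P h := exists (J : finType) (u v : J -> R -> R),
  [/\ forall j, smooth_on D (u j), forall j, smooth_on D (v j) &
      forall t, D t -> h t = \sum_j u j t * v j t].
apply: (@smooth_coinduction D P); last first.
  by exists unit, (fun=> f), (fun=> g); split => // t _;
    rewrite big_const card_unit /= addr0.
move=> h [J [u [v [su sv hE]]]].
have [u' [su' du]] := smooth_has_deriv_fam su.
have [v' [sv' dv]] := smooth_has_deriv_fam sv.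
exists (fun t => \sum_j (u' j t * v j t + u j t * v' j t)).
  exists (J + J)%type, (fun j => match j with inl j => u' j | inr j => u j end),
    (fun j => match j with inl j => v j | inr j => v' j end).
  split; [by case|by case|] => t _.
  by rewrite big_sumType big_split.
move=> t Dt; apply: (@has_deriv_ext _ _ (fun t => \sum_j u j t * v j t)) => //.
  by move=> s /hE.
by apply: has_deriv_sum => j; apply: has_derivM; auto.
Qed.

Lemma smoothN D f : smooth_on D f -> smooth_on D (fun t => - f t).
Proof.
move=> /(smoothM (smooth_cst D (-1))); apply: smooth_ext => t _.
by rewrite mulN1r.
Qed.

Lemma smoothB D f g : smooth_on D f -> smooth_on D g ->
  smooth_on D (fun t => f t - g t).
Proof. by move=> sf /smoothN; exact: smoothD. Qed.

Lemma smooth_prod D (J : Type) (r : seq J) (f : J -> R -> R) :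
  (forall j, smooth_on D (f j)) -> smooth_on D (fun t => \prod_(j <- r) f j t).
Proof.
move=> sf; elim: r => [|j r IH].
  by under eq_fun do rewrite big_nil; exact: smooth_cst.
by under eq_fun do rewrite big_cons; exact: smoothM.
Qed.

(** The functions [u / f ^ n] with [u] smooth are stable under
    differentiation. *)
Lemma smoothV D f : (forall t, D t -> f t != 0) -> smooth_on D f ->
  smooth_on D (fun t => (f t)^-1).
Proof.
move=> f0 sf.
pose P h := exists u n, smooth_on D u /\
  forall t, D t -> h t = u t * (f t)^-1 ^+ n.+1.
apply: (@smooth_coinduction D P); last first.
  by exists (cst 1), 0%N; split => [|t _];
    [exact: smooth_cst|rewrite mul1r expr1].
move=> h [u [n [su hE]]].
have [u' su' du] := smooth_has_deriv su.
have [f' sf' df] := smooth_has_deriv sf.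
exists (fun t => (u' t * f t - n.+1%:R * (u t * f' t)) * (f t)^-1 ^+ n.+2).
  exists (fun t => u' t * f t - n.+1%:R * (u t * f' t)), n.+1; split => //.
  apply: smoothB; first exact: smoothM.
  by apply: smoothM; [exact: smooth_cst|exact: smoothM].
move=> t Dt.
apply: (@has_deriv_ext _ _ (fun t => u t * (f t)^-1 ^+ n.+1)) => //.
  by move=> s /hE.
have := has_derivM (du t Dt) (has_derivX (n := n)
  (has_derivV (f0 t Dt) (df t Dt))).
congr has_deriv; have := f0 t Dt => ft0.
rewrite !exprS expr0 mulr1; by set q := _ ^+ n; field.
Qed.

Lemma smooth_det D n (A : R -> 'M[R]_n) :
  (forall i j, smooth_on D (fun t => A t i j)) ->
  smooth_on D (fun t => \det (A t)).
Proof.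
move=> sA; apply: smooth_sum => s; apply: smoothM; first exact: smooth_cst.
by apply: smooth_prod => i; exact: sA.
Qed.

Lemma smooth_mulmx D m n p (A : R -> 'M[R]_(m, n)) (B : R -> 'M[R]_(n, p)) :
  (forall i j, smooth_on D (fun t => A t i j)) ->
  (forall i j, smooth_on D (fun t => B t i j)) ->
  forall i j, smooth_on D (fun t => (A t *m B t) i j).
Proof.
move=> sA sB i j; under eq_fun do rewrite mxE.
by apply: smooth_sum => k; exact: smoothM.
Qed.

Lemma smooth_invmx D n (A : R -> 'M[R]_n) :
  (forall i j, smooth_on D (fun t => A t i j)) ->
  (forall t, D t -> \det (A t) != 0) ->
  forall i j, smooth_on D (fun t => invmx (A t) i j).
Proof.
move=> sA d0 i j.
apply: (@smooth_ext _ (fun t => (\det (A t))^-1 * \adj (A t) i j)).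
  by move=> t Dt; rewrite /invmx unitmxE unitfE d0 // [in RHS]mxE.
apply: smoothM; first by apply: smoothV => //; exact: smooth_det.
under eq_fun do rewrite mxE; apply: smoothM; first exact: smooth_cst.
apply: smooth_det => k l; under eq_fun do rewrite !mxE; exact: sA.
Qed.

End Smooth.

(** * Antiderivatives on an arbitrary interval *)

Section Antiderivative.
Variable R : realType.
Implicit Types (I : set R) (f g : R -> R) (t l : R).

Lemma interval_itv (a b : R) : is_interval [set` `[a, b]].
Proof.
move=> x y /=; rewrite !in_itv /= => /andP[ax _] /andP[_ yb] z /andP[xz zy].
by rewrite in_itv /= (le_trans ax xz) (le_trans zy yb).
Qed.

(** Reduces local statements and bounds on [I] to compact subintervals that
    contain [t0], whether or not [I] is bounded or contains its end points. *)
Lemma compact_itv_nbhs I t0 t : is_interval I ->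
  (exists a b, [/\ I a, I b & a < b]) -> I t0 -> I t ->
  exists a b d, [/\ a < b, 0 < d, I a /\ I b, a <= t0 <= b &
    forall s, I s -> `|s - t| < d -> a <= s <= b].
Proof.
move=> iI [u [v [Iu Iv uv]]] It0 It.
have right : exists b d, [/\ I b, t0 <= b, t <= b, 0 < d &
    (t < b /\ forall s, `|s - t| < d -> s <= b) \/ forall s, I s -> s <= t].
  have [[b [Ib tb]]|H] := pselect (exists b, I b /\ t < b).
    exists (Num.max b t0), (b - t); split; rewrite ?le_max ?lexx ?orbT //.
    - by case: leP.
    - by rewrite ltW.
    - by rewrite subr_gt0.
    - left; rewrite lt_max tb; split => // s; rewrite ltr_norml => /andP[_].
      by rewrite ltrD2r le_max => /ltW ->.
  have H' s : I s -> s <= t by move=> Is; rewrite leNgt; apply/negP => ts;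
    apply: H; exists s.
  by exists t, 1; split => //; [exact: H'|right].
have left_ : exists a d, [/\ I a, a <= t0, a <= t, 0 < d &
    (a < t /\ forall s, `|s - t| < d -> a <= s) \/ forall s, I s -> t <= s].
  have [[a [Ia ta]]|H] := pselect (exists a, I a /\ a < t).
    exists (Num.min a t0), (t - a); split; rewrite ?ge_min ?lexx ?orbT //.
    - by case: leP.
    - by rewrite ltW.
    - by rewrite subr_gt0.
    - left; rewrite gt_min ta; split => // s; rewrite ltr_norml => /andP[+ _].
      by rewrite opprB ltrD2r ge_min => /ltW ->.
  have H' s : I s -> t <= s by move=> Is; rewrite leNgt; apply/negP => ts;
    apply: H; exists s.
  by exists t, 1; split => //; [exact: H'|right].
have [b [d [Ib t0b tb d0 Hb]]] := right.
have [a [e [Ia at0 at_ e0 Ha]]] := left_.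
exists a, b, (Num.min d e); split => //.
- case: Hb => [[tb' _]|Hb]; first exact: le_lt_trans tb'.
  case: Ha => [[at' _]|Ha]; first exact: lt_le_trans tb.
  have := le_lt_trans (Ha _ Iu) uv; rewrite ltNge; by rewrite Hb.
- by rewrite lt_min d0.
- by rewrite at0.
- move=> s Is; rewrite lt_min => /andP[sd se]; apply/andP; split.
    by case: Ha => [[_ /(_ s se)]|/(_ s Is)] //; exact: le_trans.
  by case: Hb => [[_ /(_ s sd)]|/(_ s Is)] // /le_trans; apply.
Qed.

Lemma antiderivative_itv (a b : R) f : a < b ->
  {within `[a, b], continuous f} ->
  exists F, forall t, a <= t <= b -> has_deriv `[a, b]%classic F t (f t).
Proof.
move=> ab /subspace_continuousP cf.
(* freezing [f] beyond the end points makes it continuous on the whole line *)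
pose clamp x := Num.max a (Num.min b x).
have clampP x : [\/ x <= a /\ clamp x = a, a <= x <= b /\ clamp x = x |
    b <= x /\ clamp x = b].
  have [xa|ax] := leP x a.
    by constructor 1; rewrite /clamp min_r ?max_l //; lra.
  have [bx|xb] := leP b x.
    by constructor 3; rewrite /clamp min_l // max_r // ltW.
  by constructor 2; rewrite /clamp min_r ?max_r ?ltW.
have clamp_itv x : a <= clamp x <= b.
  by case: (clampP x) => -[h ->]; rewrite ?lexx ?(ltW ab).
have clampE x : a <= x <= b -> clamp x = x by case: (clampP x) => -[h ->] //;
  lra.
have clamp_lip x y : `|clamp x - clamp y| <= `|x - y|.
  have h1 := ler_norm (x - y); have h2 := ler_norm (y - x).
  rewrite distrC in h2; rewrite ler_norml.
  by case: (clampP x) => -[h3 ->]; case: (clampP y) => -[h4 ->]; lra.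
pose g x := f (clamp x).
have cg : continuous g.
  move=> x; apply/cvgrPdist_lt => e e0.
  have /cvgrPdist_lt/(_ _ e0)/near_nbhsP[d d0 H] := cf (clamp x) (clamp_itv x).
  apply/nbhs_ballP; exists d => // s; rewrite /= distrC => sd.
  by apply: H; [exact: clamp_itv|exact: le_lt_trans sd].
pose mu := @lebesgue_measure R.
have ig : mu.-integrable `[a - 1, b + 1] (EFin \o g).
  apply: continuous_compact_integrable; first exact: segment_compact.
  exact: continuous_subspaceT.
exists (fun x => \int[mu]_(t in [set` `[a - 1, x]]) (g t))%R => t tab.
apply: is_derive_has_deriv.
have [|||dF gE] := @continuous_FTC1_closed R g (a - 1) t (b + 1) _ ig.
- by case/andP: tab; lra.
- by case/andP: tab; lra.
- exact: cg.
have <- : g t = f t by rewrite /g clampE.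
by rewrite -gE derive1E; exact: derivableP.
Qed.

(** The primitives vanishing at [t0] on the compact subintervals containing
    [t0] agree where two of them are defined, since their difference has
    derivative [0]; so they glue. *)
Lemma antiderivative I t0 f : is_interval I ->
  (exists a b, [/\ I a, I b & a < b]) -> I t0 -> {within I, continuous f} ->
  exists2 F, F t0 = 0 & forall t, I t -> has_deriv I F t (f t).
Proof.
move=> iI nI It0 cf.
pose local_primitive a b G :=
  G t0 = 0 /\ forall t, a <= t <= b -> has_deriv `[a, b]%classic G t (f t).
have sub a b : I a -> I b -> `[a, b] `<=` I.
  by move=> Ia Ib s /=; rewrite in_itv /=; exact: iI.
have local a b : a < b -> I a -> I b -> exists G, local_primitive a b G.
  move=> ab Ia Ib.
  have [G dG] := antiderivative_itv ab
    (continuous_subspaceW (sub _ _ Ia Ib) cf).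
  exists (fun t => G t - G t0); split => [|t tab]; first by rewrite subrr.
  by have := has_derivB (dG t tab) (has_deriv_cst _ (G t0) t); rewrite subr0.
have unique a b c d G H t : local_primitive a b G -> local_primitive c d H ->
    a <= t <= b -> c <= t <= d -> a <= t0 <= b -> c <= t0 <= d -> G t = H t.
  move=> [G0 dG] [H0 dH] tab tcd t0ab t0cd.
  have iJ := @interval_itv (Num.max a c) (Num.min b d).
  have memJ s : a <= s <= b -> c <= s <= d ->
    [set` `[Num.max a c, Num.min b d]] s.
    move=> /andP[? ?] /andP[? ?]; rewrite /= in_itv /= ge_max le_min.
    by apply/andP; split; apply/andP.
  have := @has_deriv0_cst _ _ (fun s => G s - H s) t0 t iJ (memJ _ t0ab t0cd)
    (memJ _ tab tcd).
  rewrite G0 H0 subrr => E; apply/eqP; rewrite -subr_eq0; apply/eqP; apply: E.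
  move=> s /=; rewrite in_itv /= ge_max le_min => /andP[/andP[? ?] /andP[? ?]].
  rewrite -(subrr (f s)); apply: has_derivB.
    apply: has_deriv_subset (dG s _); last by apply/andP.
    by move=> u /=; rewrite !in_itv /= ge_max le_min =>
      /andP[/andP[-> _] /andP[-> _]].
  apply: has_deriv_subset (dH s _); last by apply/andP.
  by move=> u /=; rewrite !in_itv /= ge_max le_min =>
    /andP[/andP[_ ->] /andP[_ ->]].
have /choice[F FP] : forall t, exists y, I t -> forall a b G,
    local_primitive a b G -> a <= t <= b -> a <= t0 <= b -> G t = y.
  move=> t; have [It|nIt] := pselect (I t); last by exists 0.
  have [a [b [d [ab d0 [Ia Ib] t0ab near]]]] := compact_itv_nbhs iI nI It0 It.
  have tab : a <= t <= b by apply: near => //; rewrite subrr normr0.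
  have [G GP] := local a b ab Ia Ib.
  by exists (G t) => _ c e H HP tce t0ce; exact: unique HP GP _ _ _ _.
have FE t : I t -> exists a b d G, [/\ a < b, 0 < d, local_primitive a b G,
    (forall s, I s -> `|s - t| < d -> a <= s <= b) &
    forall s, a <= s <= b -> F s = G s].
  move=> It.
  have [a [b [d [ab d0 [Ia Ib] t0ab near]]]] := compact_itv_nbhs iI nI It0 It.
  have [G GP] := local a b ab Ia Ib.
  exists a, b, d, G; split => // s sab; symmetry; apply: FP GP _ _ => //.
  exact: iI sab.
exists F.
  have [a [b [d [G [_ d0 [G0 _] near FG]]]]] := FE t0 It0.
  by rewrite FG ?G0 //; apply: near => //; rewrite subrr normr0.
move=> t It; have [a [b [d [G [ab d0 [_ dG] near FG]]]]] := FE t It.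
have tab : a <= t <= b by apply: near => //; rewrite subrr normr0.
apply: (has_deriv_local d0 near); rewrite -[X in has_deriv X]/([set` `[a, b]]).
apply: (@has_deriv_ext _ _ G) (dG t tab) => //.
by move=> s /=; rewrite in_itv /= => /FG.
Qed.

End Antiderivative.

(** * Linear differential systems on an arbitrary interval *)

Section LinearODE.
Variable R : realType.
Implicit Types (D I : set R) (f g : R -> R) (t : R).

Lemma le0_of_le_half_pow (r C : R) : (forall n, r <= C / 2 ^+ n) -> r <= 0.
Proof.
move=> H; rewrite leNgt; apply/negP => r0.
have C0 : 0 < C by have := H 0%N; rewrite expr0 divr1; exact: lt_le_trans.
have := archi_boundP (divr_ge0 (ltW C0) (ltW r0)); set n := Num.bound _ => Hn.
have := H n; rewrite ler_pdivlMr ?exprn_gt0 // leNgt => /negP; apply.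
rewrite ltr_pdivrMr // in Hn; apply: lt_trans Hn _; rewrite mulrC ltr_pM2l //.
by rewrite -natrX ltr_nat ltn_expl.
Qed.

(** The sequences [u n - 2 * C / 2 ^+ n] and [u n + 2 * C / 2 ^+ n] are
    respectively nondecreasing and nonincreasing, so the supremum of the former
    lies between them. *)
Lemma geometric_cauchy (u : nat -> R) (C : R) :
  (forall n, `|u n.+1 - u n| <= C / 2 ^+ n) ->
  exists l, forall n, `|l - u n| <= 2 * C / 2 ^+ n.
Proof.
move=> H; pose d n : R := 2 * C / 2 ^+ n.
have dS n : d n = d n.+1 + C / 2 ^+ n.
  by rewrite /d exprS; field; rewrite expf_neq0.
have C0 : 0 <= C.
  by have := le_trans (normr_ge0 _) (H 0%N); rewrite expr0 divr1.
have d0 n : 0 <= d n by rewrite divr_ge0 ?exprn_ge0 // mulr_ge0.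
pose v n := u n - d n; pose w n := u n + d n.
have vS n : v n <= v n.+1.
  by have := H n; rewrite ler_norml /v (dS n) => /andP[? ?]; lra.
have wS n : w n.+1 <= w n.
  by have := H n; rewrite ler_norml /w (dS n) => /andP[? ?]; lra.
have vm : {homo v : n k / (n <= k)%N >-> n <= k} by exact: homo_leq le_trans vS.
have wm : {homo w : n k / (n <= k)%N >-> k <= n}.
  by apply: homo_leq => [//|? ? ? h1 h2|//]; exact: le_trans h2 h1.
have vw n k : v n <= w k.
  apply: le_trans (vm _ _ (leq_maxl n k)) _.
  apply: le_trans (wm _ _ (leq_maxr n k)).
  by have := d0 (maxn n k); rewrite /v /w; lra.
exists (sup (range v)) => n.
have h1 : v n <= sup (range v).
  by apply: ub_le_sup; [exists (w 0%N) => _ [k _ <-]|exists n].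
have h2 : sup (range v) <= w n.
  by apply: ge_sup; [exists (v 0%N), 0%N|move=> _ [k _ <-]].
by rewrite ler_norml; move: h1 h2; rewrite /v /w -/(d n); lra.
Qed.

Lemma continuous_itv_bounded I f (a b : R) : is_interval I -> I a -> I b ->
  a <= b -> {within I, continuous f} ->
  exists M, forall t, a <= t <= b -> `|f t| <= M.
Proof.
move=> iI Ia Ib ab cf.
have cf' : {within `[a, b], continuous f}.
  apply: continuous_subspaceW cf => s /=; rewrite in_itv /=; exact: iI.
have [c _ cM] := EVT_max ab cf'; have [d _ dm] := EVT_min ab cf'.
exists (Num.max (f c) (- f d)) => t tab; rewrite ler_norml lerNl !le_max.
by rewrite cM ?in_itv //= lerN2 dm ?in_itv //= orbT.
Qed.

Lemma within_continuous_sumM I (T : finType) (u v : T -> R -> R) :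
  (forall j, {within I, continuous (u j)}) ->
  (forall j, {within I, continuous (v j)}) ->
  {within I, continuous (fun t => \sum_j u j t * v j t)}.
Proof.
move=> cu cv x; apply: cvg_big => [|j _]; first exact: add_continuous.
by apply: cvgM; [exact: cu|exact: cv].
Qed.

(** Integrating from [t0] a function dominated by [K] times the weight
    [expR (2 * K * `|t - t0|)] gains a factor [1 / 2], over an interval of any
    length. *)
Lemma has_deriv_expR_bound D t0 (K C : R) g g' : is_interval D -> D t0 ->
  0 < K -> g t0 = 0 -> (forall t, D t -> has_deriv D g t (g' t)) ->
  (forall t, D t -> `|g' t| <= K * (C * expR (2 * K * `|t - t0|))) ->
  forall t, D t -> `|g t| <= C / 2 * expR (2 * K * `|t - t0|).
Proof.
move=> iD Dt0 K0 g0 dg bg t Dt.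
have C0 : 0 <= C.
  have := le_trans (normr_ge0 _) (bg t Dt).
  by rewrite pmulr_rge0 // pmulr_lge0 ?expR_gt0.
have [->|tt0] := eqVneq t t0.
  by rewrite g0 normr0 mulr_ge0 ?expR_ge0 // divr_ge0.
pose k := 2 * K * Num.sg (t - t0).
have kE s : 0 < (s - t0) * (t - t0) -> k * (s - t0) = 2 * K * `|s - t0|.
  move=> h; rewrite /k -mulrA; congr (_ * _).
  have : Num.sg ((s - t0) * (t - t0)) = 1 by rewrite gtr0_sg.
  rewrite sgrM [`|s - t0|]normrEsg.
  by case: sgrP => _; case: sgrP => _;
    rewrite ?(mul0r, mulr0, mul1r, mulr1, mulN1r, mulrN1, opprK, oppr0); lra.
pose h s := expR (k * (s - t0)).
have dh s : D s -> has_deriv D h s (k * h s).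
  move=> _; apply: is_derive_has_deriv; rewrite mulrC.
  apply: (@is_derive1_comp _ expR (fun s => k * (s - t0))).
  apply: (@has_deriv_is_derive _ setT); first exact: filterT.
  have := has_derivZ (c := k) (has_derivB (has_deriv_id setT s)
    (has_deriv_cst setT t0 s)).
  by rewrite subr0 mulr1.
have [c [Dc cp cd E]] := has_deriv_cauchy_MVT iD Dt0 Dt tt0 dg dh.
have ht : h t = expR (2 * K * `|t - t0|).
  by rewrite /h kE // -expr2 exprn_even_gt0 // subr_eq0 tt0 orbT.
have hc : h c = expR (2 * K * `|c - t0|) by rewrite /h kE.
have ht0 : h t0 = 1 by rewrite /h subrr mulr0 expR0.
have ht1 : 1 <= h t.
  by rewrite ht -expR0 ler_expR mulr_ge0 // mulr_ge0 // ltW.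
have hc0 : 0 < h c by exact: expR_gt0.
have kN : `|k| = 2 * K.
  by rewrite /k !normrM normr_sg subr_eq0 tt0 mulr1 !gtr0_norm.
move: E; rewrite g0 subr0 ht0 => /(congr1 Num.norm).
rewrite normrM [`|k * _|]normrM kN [in RHS]normrM (gtr0_norm hc0).
rewrite (ger0_norm (_ : 0 <= h t - 1)); last by lra.
move=> E.
have := ler_wpM2l (_ : 0 <= h t - 1) (bg c Dc); rewrite -E -hc => /(_ _) bound.
rewrite -ht -(ler_pM2r (_ : 0 < 2 * K * h c)); last by rewrite !mulr_gt0.
apply: (le_trans (bound _)); first by lra.
rewrite -subr_ge0.
have -> : C / 2 * h t * (2 * K * h c) - (h t - 1) * (K * (C * h c)) =
   C * K * h c by field.
by rewrite !mulr_ge0 // ltW.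
Qed.

Section System.
Variables (T : finType) (A : T -> T -> R -> R).

Definition ode_solution I (x : T -> R -> R) :=
  forall i t, I t -> has_deriv I (x i) t (\sum_j A i j t * x j t).

(** Each Picard step costs a factor [K] and one integration, so the weighted
    bound is halved at each step: the series of the differences converges
    geometrically on the whole of [D], without cutting [D] into short
    pieces. *)
Lemma picard_bound D t0 (K M : R) (e : nat -> T -> R -> R) :
  is_interval D -> D t0 -> 0 < K ->
  (forall i t, D t -> \sum_j `|A i j t| <= K) ->
  (forall i t, D t -> `|e 0 i t| <= M) ->
  (forall n i, e n.+1 i t0 = 0) ->
  (forall n i t, D t -> has_deriv D (e n.+1 i) t (\sum_j A i j t * e n j t)) ->
  forall n i t, D t -> `|e n i t| <= M / 2 ^+ n * expR (2 * K * `|t - t0|).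
Proof.
move=> iD Dt0 K0 AK e0 et0 de; elim=> [|n IH] i t Dt.
  have M0 : 0 <= M := le_trans (normr_ge0 _) (e0 i t Dt).
  rewrite expr0 divr1; apply: le_trans (e0 i t Dt) _.
  rewrite ler_peMr // -[X in X <= _]expR0 ler_expR mulr_ge0 // mulr_ge0 // ltW
    //.
have -> : M / 2 ^+ n.+1 = M / 2 ^+ n / 2 by rewrite exprS invfM mulrCA mulrC.
apply: (has_deriv_expR_bound iD Dt0 K0 (et0 n i) (de n i)) => // s Ds.
apply: le_trans (ler_norm_sum _ _ _) _.
set B := _ * expR _.
have B0 : 0 <= B by apply: le_trans (normr_ge0 _) (IH i s Ds).
apply: le_trans (ler_wpM2r B0 (AK i s Ds)); rewrite mulr_suml.
by apply: ler_sum => j _; rewrite normrM ler_wpM2l //; exact: IH.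
Qed.


Variable I : set R.
Hypotheses (iI : is_interval I) (nI : exists a b, [/\ I a, I b & a < b]).
Hypothesis cA : forall i j, {within I, continuous (A i j)}.

Lemma ode_coef_bounded (a b : R) : I a -> I b -> a <= b ->
  exists2 K, 0 < K & forall i t, a <= t <= b -> \sum_j `|A i j t| <= K.
Proof.
move=> Ia Ib ab.
have /choice[M MP] : forall p : T * T, exists M,
    forall t, a <= t <= b -> `|A p.1 p.2 t| <= M.
  by move=> p; exact: (continuous_itv_bounded iI Ia Ib ab (@cA p.1 p.2)).
have M0 p : 0 <= M p.
  by apply: le_trans (normr_ge0 _) (MP p a _); rewrite lexx.
exists (1 + \sum_i \sum_j M (i, j)) => [|i t tab].
  by rewrite ltr_pwDl // sumr_ge0 // => i _; rewrite sumr_ge0.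
apply: (@le_trans _ _ (\sum_j M (i, j))).
  by apply: ler_sum => j _; exact: (MP (i, j)).
rewrite ler_wpDl // [leRHS](bigD1 i) //= lerDl sumr_ge0 // => j _.
by rewrite sumr_ge0.
Qed.

Lemma ode_fam_bounded (a b : R) (x : T -> R -> R) : I a -> I b -> a <= b ->
  (forall i, {within I, continuous (x i)}) ->
  exists2 M, 0 <= M & forall i t, a <= t <= b -> `|x i t| <= M.
Proof.
move=> Ia Ib ab cx.
have /choice[M MP] : forall i : T, exists M,
    forall t, a <= t <= b -> `|x i t| <= M.
  by move=> i; exact: (continuous_itv_bounded iI Ia Ib ab (cx i)).
have M0 p : 0 <= M p.
  by apply: le_trans (normr_ge0 _) (MP p a _); rewrite lexx.
exists (\sum_i M i) => [|i t tab]; first by rewrite sumr_ge0.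
by rewrite (bigD1 i) //= ler_wpDr ?MP // sumr_ge0.
Qed.

(** A solution vanishing at [t0] is its own Picard iterate, so the bounds of
    the iteration hold for it at every stage. *)
Lemma ode_unique (x : T -> R -> R) (t0 : R) : I t0 -> ode_solution I x ->
  (forall i, x i t0 = 0) -> forall i t, I t -> x i t = 0.
Proof.
move=> It0 dx x0 i t It.
have [a [b [d [ab d0 [Ia Ib] t0ab near]]]] := compact_itv_nbhs iI nI It0 It.
have tab : a <= t <= b by apply: near => //; rewrite subrr normr0.
have [K K0 AK] := ode_coef_bounded Ia Ib (ltW ab).
have [M M0 xM] := ode_fam_bounded Ia Ib (ltW ab)
  (fun j => has_deriv_continuous (dx j)).
have sub : `[a, b] `<=` I by move=> s /=; rewrite in_itv /=; exact: iI.
have bound := @picard_bound `[a, b]%classic t0 K M (fun _ => x)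
  (@interval_itv _ a b) t0ab K0 AK xM (fun _ => x0)
  (fun _ j s sab => has_deriv_subset sub (dx j s (sub _ sab))).
apply/eqP; rewrite -normr_eq0 eq_le normr_ge0 andbT.
apply: (@le0_of_le_half_pow _ (M * expR (2 * K * `|t - t0|))) => n.
by rewrite mulrAC; exact: bound.
Qed.

(** The Picard iterates [y n] converge geometrically, uniformly on each compact
    subinterval containing [t0]. Their limit [X] is continuous; its next
    iterate [next X] is the limit of the [y n.+1] as well. Hence [X = next X],
    and the right-hand side is differentiable by construction. *)
Lemma ode_exists (x0 : T -> R) (t0 : R) : I t0 ->
  exists2 x, ode_solution I x & forall i, x i t0 = x0 i.
Proof.
move=> It0.
have /choice[prim primP] : forall f, exists F, {within I, continuous f} ->
    F t0 = 0 /\ forall t, I t -> has_deriv I F t (f t).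
  move=> f; have [cf|ncf] := pselect {within I, continuous f}; last by exists f.
  by have [F F0 dF] := antiderivative iI nI It0 cf; exists F.
pose next (y : T -> R -> R) i t :=
  x0 i + prim (fun t => \sum_j A i j t * y j t) t.
have next_t0 y i : (forall j, {within I, continuous (y j)}) ->
  next y i t0 = x0 i.
  move=> cy; rewrite /next; have [->] :=
    primP _ (within_continuous_sumM (@cA i) cy).
  by rewrite addr0.
have dnext y i t : (forall j, {within I, continuous (y j)}) -> I t ->
    has_deriv I (next y i) t (\sum_j A i j t * y j t).
  move=> cy It; have [_ /(_ t It) dp] :=
    primP _ (within_continuous_sumM (@cA i) cy).
  by have := has_derivD (has_deriv_cst I (x0 i) t) dp; rewrite add0r.
have cnext y : (forall j, {within I, continuous (y j)}) ->
    forall i, {within I, continuous (next y i)}.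
  by move=> cy i; apply: (has_deriv_continuous (f' := fun t => _)) => t;
    exact: dnext.
pose y n := iter n next (fun i => cst (x0 i)).
have cy n i : {within I, continuous (y n i)}.
  elim: n i => [|n IH] i; last exact: cnext.
  by apply: (has_deriv_continuous (f' := cst 0)) => t _; exact: has_deriv_cst.
have yt0 n i : y n i t0 = x0 i by case: n => [//|n]; exact: next_t0.
have dy n i t : I t -> has_deriv I (y n.+1 i) t (\sum_j A i j t * y n j t).
  exact: dnext.
have step a b : I a -> I b -> a <= t0 <= b -> a <= b -> exists B,
    forall n i t, a <= t <= b -> `|y n.+1 i t - y n i t| <= B / 2 ^+ n.
  move=> Ia Ib t0ab ab.
  have [K K0 AK] := ode_coef_bounded Ia Ib ab.
  have sub : `[a, b] `<=` I by move=> s /=; rewrite in_itv /=; exact: iI.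
  pose e n i t := y n.+1 i t - y n i t.
  have ce i : {within I, continuous (e 0%N i)}.
    by move=> s; apply: cvgB; [exact: (cy 1%N)|exact: (cy 0%N)].
  have [M M0 eM] := ode_fam_bounded Ia Ib ab ce.
  have de n i t : `[a, b]%classic t ->
      has_deriv `[a, b]%classic (e n.+1 i) t (\sum_j A i j t * e n j t).
    move=> tab; have It := sub _ tab; apply: (has_deriv_subset sub).
    have := has_derivB (dy n.+1 i t It) (dy n i t It); rewrite -sumrB.
    by under eq_bigr do rewrite -mulrBr.
  have et0 n i : e n.+1 i t0 = 0 by rewrite /e !yt0 subrr.
  have bound := picard_bound (@interval_itv _ a b) t0ab K0 AK eM et0 de.
  exists (M * expR (2 * K * (b - a))) => n i t tab.
  apply: le_trans (bound n i t tab) _; rewrite mulrAC ler_wpM2r //.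
  rewrite ler_wpM2l // ler_expR; apply: ler_wpM2l;
    first by rewrite mulr_ge0 // ltW.
  by rewrite ler_norml; move: tab t0ab => /andP[? ?] /andP[? ?]; lra.
have /choice[x xP] : forall p : T * R, exists l, I p.2 -> forall a b B,
    I a -> I b -> a <= t0 <= b -> a <= p.2 <= b ->
    (forall n i t, a <= t <= b -> `|y n.+1 i t - y n i t| <= B / 2 ^+ n) ->
    forall n, `|l - y n p.1 p.2| <= 2 * B / 2 ^+ n.
  move=> [i t]; have [It|nIt] := pselect (I t); last by exists 0.
  have [a [b [d [ab d0 [Ia Ib] t0ab near]]]] := compact_itv_nbhs iI nI It0 It.
  have tab : a <= t <= b by apply: near => //; rewrite subrr normr0.
  have [B yB] := step a b Ia Ib t0ab (ltW ab).
  have [l lP] := geometric_cauchy (fun n => yB n i t tab).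
  exists l => _ a' b' B' _ _ _ tab' yB' n.
  have [l' lP'] := geometric_cauchy (fun n => yB' n i t tab').
  suff -> : l = l' by exact: lP'.
  apply/eqP; rewrite -subr_eq0 -normr_eq0 eq_le normr_ge0 andbT.
  apply: (@le0_of_le_half_pow _ (2 * B + 2 * B')) => k.
  rewrite mulrDl; apply: le_trans (lerD (lP k) (lP' k)).
  by rewrite [`|l' - _|]distrC; apply: le_trans (ler_normD _ _);
    rewrite addrA subrK.
pose X i t := x (i, t).
have XB a b : I a -> I b -> a <= t0 <= b -> a <= b -> exists2 B, 0 <= B &
    forall n i t, a <= t <= b -> `|X i t - y n i t| <= B / 2 ^+ n.
  move=> Ia Ib t0ab ab; have [B yB] := step a b Ia Ib t0ab ab.
  exists (`|2 * B|) => // n i t tab.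
  have It : I t by exact: iI tab.
  apply: le_trans (xP (i, t) It a b B Ia Ib t0ab tab yB n) _.
  by rewrite ler_wpM2r ?ler_norm // invr_ge0 exprn_ge0.
(* a uniform limit on a neighbourhood of each point *)
have cX i : {within I, continuous (X i)}.
  apply/subspace_continuousP => t It; apply/cvgrPdist_lt => e e0.
  have [a [b [d [ab d0 [Ia Ib] t0ab near]]]] := compact_itv_nbhs iI nI It0 It.
  have tab : a <= t <= b by apply: near => //; rewrite subrr normr0.
  have [B B0 BP] := XB a b Ia Ib t0ab (ltW ab).
  have [n nP] : exists n, B / 2 ^+ n < e / 3.
    apply/not_existsP => H; have : e / 3 <= 0.
      by apply: (@le0_of_le_half_pow _ B) => n; rewrite leNgt; exact/negP.
    by rewrite leNgt divr_gt0.
  have /subspace_continuousP/(_ t It)/cvgrPdist_lt/(_ (e / 3) _)/near_nbhsP :=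
    cy n i.
  move=> [|r r0 Hr]; first by rewrite divr_gt0.
  apply/near_nbhsP; exists (Num.min d r); first by rewrite lt_min d0.
  move=> s Is; rewrite lt_min => /andP[sd sr].
  have h1 := BP n i t tab; have h2 := BP n i s (near s Is sd).
  have h3 := Hr s Is sr.
  have -> : X i t - X i s = (X i t - y n i t) + (y n i t - y n i s) -
    (X i s - y n i s) by ring.
  apply: le_lt_trans (ler_normB _ _) _.
  have h4 := ler_normD (X i t - y n i t) (y n i t - y n i s).
  lra.
have XE i t : I t -> X i t = next X i t.
  move=> It.
  have [a [b [d [ab d0 [Ia Ib] t0ab near]]]] := compact_itv_nbhs iI nI It0 It.
  have tab : a <= t <= b by apply: near => //; rewrite subrr normr0.
  have [B B0 BP] := XB a b Ia Ib t0ab (ltW ab).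
  have [K K0 AK] := ode_coef_bounded Ia Ib (ltW ab).
  have sub : `[a, b] `<=` I by move=> s /=; rewrite in_itv /=; exact: iI.
  have near_next n : `|next X i t - y n.+1 i t| <= K * (B / 2 ^+ n) * (b - a).
    have [->|tt0] := eqVneq t t0.
      rewrite next_t0 // yt0 subrr normr0 mulr_ge0 ?subr_ge0 ?(ltW ab) //.
      by rewrite mulr_ge0 ?(ltW K0) // divr_ge0 // exprn_ge0.
    have dD s : `[a, b]%classic s -> has_deriv `[a, b]%classic
        (fun s => next X i s - y n.+1 i s) s
          (\sum_j A i j s * (X j s - y n j s)).
      move=> sab; have Is := sub _ sab; apply: (has_deriv_subset sub).
      have := has_derivB (dnext _ i s cX Is) (dy n i s Is); rewrite -sumrB.
      by under eq_bigr do rewrite -mulrBr.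
    have [c [cab _ _]] := has_deriv_cauchy_MVT (@interval_itv _ a b) t0ab tab
      tt0
      dD (fun s _ => has_deriv_id _ s).
    rewrite next_t0 // yt0 subrr subr0 mulr1 => ->; rewrite normrM mulrC.
    apply: ler_pM => //.
      apply: le_trans (ler_norm_sum _ _ _) _.
      have BK : 0 <= B / 2 ^+ n by rewrite divr_ge0 // exprn_ge0.
      apply: le_trans (ler_wpM2r BK (AK i c cab)); rewrite mulr_suml.
      by apply: ler_sum => j _; rewrite normrM ler_wpM2l //; exact: BP.
    by rewrite ler_norml; move: tab t0ab => /andP[? ?] /andP[? ?]; lra.
  apply/eqP; rewrite -subr_eq0 -normr_eq0 eq_le normr_ge0 andbT.
  apply: (@le0_of_le_half_pow _ (B + K * B * (b - a))) => n.
  have h1 := BP n.+1 i t tab; have h2 := near_next n.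
  have -> : X i t - next X i t = (X i t - y n.+1 i t) -
    (next X i t - y n.+1 i t).
    by ring.
  apply: le_trans (ler_normB _ _) _; rewrite mulrDl; apply: lerD.
    apply: le_trans h1 _; rewrite ler_wpM2l // lef_pV2 ?posrE ?exprn_gt0 //.
    by rewrite ler_eXn2l // ltr1n.
  by apply: le_trans h2 _; rewrite [leRHS]mulrAC -!mulrA.
exists X; last by move=> i; rewrite XE // next_t0.
move=> i t It; apply: (has_deriv_ext (f := next X i)) => //; last exact: dnext.
by move=> s /XE ->.
Qed.

(** The combinations of the [x j] with smooth coefficients are stable under
    differentiation. *)
Lemma ode_solution_smooth (x : T -> R -> R) :
  (forall i j, smooth_on I (A i j)) -> ode_solution I x ->
  forall i, smooth_on I (x i).
Proof.
move=> sA dx i.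
pose P h := exists c : T -> R -> R, (forall j, smooth_on I (c j)) /\
  forall t, I t -> h t = \sum_j c j t * x j t.
apply: (@smooth_coinduction _ I P); last first.
  exists (fun j => cst (j == i)%:R); split => [j|t _]; first exact: smooth_cst.
  by rewrite (bigD1 i) //= eqxx mul1r big1 ?addr0 // => j /negPf ->;
    rewrite mul0r.
move=> h [c [sc hE]]; have [c' [sc' dc]] := smooth_has_deriv_fam sc.
pose c'' j t := c' j t + \sum_k c k t * A k j t.
exists (fun t => \sum_j c'' j t * x j t).
  exists c''; split => // j; apply: smoothD => //.
  by apply: smooth_sum => k; exact: smoothM.
move=> t It; apply: (@has_deriv_ext _ _ (fun t => \sum_j c j t * x j t)) => //.
  by move=> s /hE.
have -> : \sum_j c'' j t * x j t =
    \sum_j (c' j t * x j t + c j t * \sum_k A j k t * x k t).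
  rewrite big_split /=; under eq_bigr do rewrite mulrDl; rewrite big_split /=.
  congr (_ + _); under eq_bigr do rewrite mulr_suml; rewrite exchange_big /=.
  apply: eq_bigr => j _; rewrite mulr_sumr; apply: eq_bigr => k _.
  by rewrite mulrA.
by apply: has_deriv_sum => j; apply: has_derivM; [exact: dc|exact: dx].
Qed.

End System.
End LinearODE.

(** * Symplectic linear algebra *)

Section SymplecticAlgebra.
Variables (R : realType) (W : vectType R).
Variable sigma : {skew_symmetric W}.

Lemma sigmaC u v : sigma u v = - sigma v u.
Proof. by rewrite hermC expr1 mulN1r. Qed.

Lemma sigma_refl u : sigma u u = 0.
Proof. by have := sigmaC u u; lra. Qed.

Lemma sigmaDl u v w : sigma (u + v) w = sigma u w + sigma v w.
Proof. by rewrite linearDl. Qed.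

Lemma sigmaZl a u v : sigma (a *: u) v = a * sigma u v.
Proof. by rewrite linearZl. Qed.

Lemma sigma_suml (J : Type) (r : seq J) (u : J -> W) v :
  sigma (\sum_(j <- r) u j) v = \sum_(j <- r) sigma (u j) v.
Proof. by rewrite linear_sumlz. Qed.

Lemma sigmaDr u v w : sigma u (v + w) = sigma u v + sigma u w.
Proof. by rewrite linearDr. Qed.

Lemma sigmaZr a u v : sigma u (a *: v) = a * sigma u v.
Proof. by rewrite linearZr. Qed.

Lemma sigma0r u : sigma u 0 = 0.
Proof. by rewrite -(scale0r (0 : W)) sigmaZr mul0r. Qed.

Lemma sigma_sumr (J : Type) (r : seq J) (u : J -> W) v :
  sigma v (\sum_(j <- r) u j) = \sum_(j <- r) sigma v (u j).
Proof. by rewrite linear_sumr. Qed.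

Lemma mem_span_codom m (E : 'I_m -> W) w :
  w \in <<codom E>>%VS <-> exists c : 'I_m -> R, w = \sum_i c i *: E i.
Proof.
rewrite span_def codomE big_map big_enum /=; split.
  move=> /memv_sumP[v vE ->].
  have /choice[c cE] : forall i, exists a, v i = a *: E i.
    by move=> i; have /vlineP[a ->] := vE i isT; exists a.
  by exists c; apply: eq_bigr => i _; rewrite cE.
move=> [c ->]; apply: memv_suml => i _;
  apply: (subvP (sumv_sup i _ (subvv _))) => //.
by rewrite memvZ // memv_line.
Qed.


Lemma sum_delta (J : finType) (c : J -> R) i :
  \sum_j c j * (i == j)%:R = c i.
Proof.
rewrite (bigD1 i) //= eqxx mulr1 big1 ?addr0 // => j /negPf ji.
by rewrite eq_sym ji mulr0.
Qed.

Definition symplectic_family m (E F : 'I_m -> W) :=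
  [/\ forall i j, sigma (E i) (E j) = 0, forall i j, sigma (F i) (F j) = 0 &
      forall i j, sigma (F i) (E j) = (i == j)%:R].

Section Family.
Variables (m : nat) (E F : 'I_m -> W).
Hypothesis EF : symplectic_family E F.

Lemma sigma_combl c d j :
  sigma (F j) (\sum_i c i *: E i + \sum_i d i *: F i) = c j.
Proof.
have [_ FF FE] := EF; rewrite sigmaDr !sigma_sumr.
under eq_bigr do rewrite sigmaZr FE.
rewrite sum_delta big1 ?addr0 // => i _; by rewrite sigmaZr FF mulr0.
Qed.

Lemma sigma_combr c d j :
  sigma (\sum_i c i *: E i + \sum_i d i *: F i) (E j) = d j.
Proof.
have [EE _ FE] := EF; rewrite sigmaDl !sigma_suml.
under [X in _ + X]eq_bigr do rewrite sigmaZl FE eq_sym.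
rewrite sum_delta big1 ?add0r // => i _; by rewrite sigmaZl EE mulr0.
Qed.

(** The projection on the span of the family along its orthogonal. *)
Definition family_part w :=
  \sum_i sigma (F i) w *: E i + \sum_i sigma w (E i) *: F i.

Lemma family_part_orthE w j : sigma (w - family_part w) (E j) = 0.
Proof. by rewrite linearBl /= sigma_combr subrr. Qed.

Lemma family_part_orthF w j : sigma (F j) (w - family_part w) = 0.
Proof. by rewrite linearBr /= sigma_combl subrr. Qed.

End Family.

(** Pairing with the [F i] and with the [E i] reads off the coefficients of a
    linear combination. *)
Lemma symplectic_family_free m (E F : 'I_m -> W) : symplectic_family E F ->
  free (codom E ++ codom F).
Proof.
move=> EF; have [EE FF FE] := EF.
have freeJ (X : 'I_m -> W) (phi : 'I_m -> W -> R) :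
    (forall i (c : 'I_#|'I_m| -> R),
      phi (enum_val i) (\sum_j c j *: X (enum_val j)) = c i) ->
    free (codom X).
  move=> H; apply/(freeP (X := codom_tuple X)) => c c0 i.
  rewrite -(H i c); move: c0; under eq_bigr do rewrite nth_codom.
  by move=> ->; have := H i (fun=> 0); under eq_bigr do rewrite scale0r;
    rewrite big1.
rewrite cat_free; apply/and3P; split.
- apply: (freeJ _ (fun i => sigma (F i))) => i c; rewrite sigma_sumr.
  under eq_bigr do rewrite sigmaZr FE (inj_eq enum_val_inj).
  exact: sum_delta.
- apply: (freeJ _ (fun i w => sigma w (E i))) => i c; rewrite sigma_suml.
  under eq_bigr do rewrite sigmaZl FE (inj_eq enum_val_inj) eq_sym.
  exact: sum_delta.
- apply/directv_addP/eqP; rewrite -subv0; apply/subvP => w /memv_capP[].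
  move=> /mem_span_codom[c wE] /mem_span_codom[d wF]; rewrite memv0 wE.
  apply/eqP/big1 => j _; rewrite -(sigma_combl EF c (fun=> 0) j).
  under [X in _ + X]eq_bigr do rewrite scale0r.
  rewrite [X in _ + X]big1 // addr0 -wE wF sigma_sumr big1 ?scale0r // => i _.
  by rewrite sigmaZr FF mulr0.
Qed.

Lemma symplectic_family_darboux m (E F : 'I_m -> W) :
  \dim {:W} = (2 * m)%N -> symplectic_family E F -> darboux sigma E F.
Proof.
move=> dimW EF; have [EE FF FE] := EF; split => //.
by rewrite basisEfree symplectic_family_free //= subvf size_cat !size_codom
  card_ord dimW; lia.
Qed.

Lemma darboux_family m (E F : 'I_m -> W) : darboux sigma E F ->
  symplectic_family E F.
Proof. by case. Qed.

Lemma darboux_expand m (E F : 'I_m -> W) w : darboux sigma E F ->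
  w = \sum_i sigma (F i) w *: E i + \sum_i sigma w (E i) *: F i.
Proof.
move=> EFd; have EF := darboux_family EFd; have [EFb _ _ _] := EFd.
have : w \in fullv by exact: memvf.
rewrite -(span_basis EFb) span_cat => /memv_addP[u uE [v vF wE]].
have [c uc] := (mem_span_codom _ _).1 uE.
have [d vd] := (mem_span_codom _ _).1 vF.
rewrite {1}wE uc vd; congr (_ + _); apply: eq_bigr => i _; congr (_ *: _).
  by rewrite wE uc vd (sigma_combl EF).
by rewrite wE uc vd (sigma_combr EF).
Qed.

Lemma darboux_mem_span m (E F : 'I_m -> W) w : darboux sigma E F ->
  w \in <<codom E>>%VS <-> forall i, sigma w (E i) = 0.
Proof.
move=> EF; split=> [/mem_span_codom[c ->] i|H].
  have [_ EE _ _] := EF; rewrite sigma_suml big1 // => j _.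
  by rewrite sigmaZl EE mulr0.
apply/mem_span_codom; exists (fun i => sigma (F i) w).
rewrite [LHS](darboux_expand w EF) [X in _ + X]big1 ?addr0 // => i _.
by rewrite H scale0r.
Qed.

(** A vector outside the span of the family leaves a nonzero vector [e] in its
    orthogonal; nondegeneracy provides a vector pairing with [e] to a nonzero
    value, and this value does not change when it is projected to the
    orthogonal. *)
Lemma symplectic_family_extend m (E F : 'I_m -> W) :
  (2 * m < \dim {:W})%N -> nondegenerate sigma -> symplectic_family E F ->
  exists E' F' : 'I_m.+1 -> W, symplectic_family E' F'.
Proof.
move=> lt_dim nd EF; have [EE FF FE] := EF.
have [w wU] : exists w, w \notin <<codom E ++ codom F>>%VS.
  apply/not_existsP => H; have : ({:W} <= <<codom E ++ codom F>>)%VS.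
    by apply/subvP => w _; apply/negPn/negP; exact: H.
  move=> /dimvS; have := dim_span (codom E ++ codom F).
  by rewrite size_cat !size_codom card_ord; lia.
pose e := w - family_part E F w.
have e0 : e != 0.
  apply: contraNneq wU => /eqP; rewrite subr_eq0 => /eqP ->.
  rewrite span_cat; apply: memv_add; apply/mem_span_codom.
    by exists (fun i => sigma (F i) w).
  by exists (fun i => sigma w (E i)).
have [f0 sf0] : exists f, sigma f e != 0.
  have : e \notin orthov sigma fullv by rewrite (eqP nd) memv0.
  move=> /mem_orthovPn[v _ ev]; exists v; by rewrite sigmaC oppr_eq0.
pose f1 := f0 - family_part E F f0.
have eE j : sigma e (E j) = 0 by exact: family_part_orthE.
have eF j : sigma (F j) e = 0 by exact: family_part_orthF.
have f1e : sigma f1 e = sigma f0 e.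
  rewrite linearBl /= sigmaDl !sigma_suml !big1 ?addr0 ?subr0 // => i _.
    by rewrite sigmaZl eF mulr0.
  by rewrite sigmaZl (sigmaC (E i)) eE oppr0 mulr0.
pose f := (sigma f0 e)^-1 *: f1.
have fe : sigma f e = 1 by rewrite sigmaZl f1e mulVf.
have fE j : sigma f (E j) = 0 by rewrite sigmaZl family_part_orthE // mulr0.
have fF j : sigma (F j) f = 0 by rewrite sigmaZr family_part_orthF // mulr0.
exists (fun i => if unlift ord_max i is Some j then E j else e),
       (fun i => if unlift ord_max i is Some j then F j else f).
split => i j; case: unliftP => [i'|] Ei; case: unliftP => [j'|] Ej;
  rewrite ?Ei ?Ej ?(inj_eq lift_inj) ?eqxx ?sigma_refl //.
- by rewrite sigmaC eE oppr0.
- by rewrite sigmaC fF oppr0.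
- by rewrite eF eq_sym (negPf (neq_lift _ _)).
- by rewrite fE (negPf (neq_lift _ _)).
Qed.

Lemma darboux_exists m : \dim {:W} = (2 * m)%N -> nondegenerate sigma ->
  exists E F : 'I_m -> W, darboux sigma E F.
Proof.
move=> dimW nd.
have : forall k, (k <= m)%N -> exists E F : 'I_k -> W, symplectic_family E F.
  elim=> [_|k IH ltkm]; first by exists (fun=> 0), (fun=> 0); split => -[].
  have [E [F EF]] := IH (ltnW ltkm).
  by apply: symplectic_family_extend EF; rewrite ?dimW ?ltn_mul2l.
by move=> /(_ m (leqnn m))[E [F EF]]; exists E, F;
  exact: symplectic_family_darboux.
Qed.

End SymplecticAlgebra.

(** * Derivatives of curves in a vector space *)

Section VectorDerivative.
Variables (R : realType) (W : vectType R).
Implicit Types (D : set R) (u v w : R -> W) (t : R).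

Let crd := coord (vbasis {:W}).
Let bas (a : 'I_(\dim {:W})) := (vbasis {:W})`_a.

Let crdE (w : W) : w = \sum_a crd a w *: bas a.
Proof. by apply: coord_vbasis; exact: memvf. Qed.

Lemma has_vderiv_ext D u v t l : (forall s, D s -> u s = v s) -> D t ->
  has_vderiv D u t l -> has_vderiv D v t l.
Proof.
by move=> uv Dt du phi; apply: (has_deriv_ext _ Dt (du phi)) => s /uv ->.
Qed.

Lemma has_vderiv_unique D w t l k : ProperFilter (within D t^') ->
  has_vderiv D w t l -> has_vderiv D w t k -> l = k.
Proof.
move=> PF dl dk; rewrite (crdE l) (crdE k); apply: eq_bigr => a _.
by congr (_ *: _); exact: has_deriv_unique PF (dl _) (dk _).
Qed.

Lemma has_vderiv_cst D (x : W) t : has_vderiv D (cst x) t 0.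
Proof. by move=> phi; rewrite linear0; exact: (has_deriv_cst D (phi x) t). Qed.

Lemma has_vderivZ D (c : R -> R) w t l k : has_deriv D c t l ->
  has_vderiv D w t k -> has_vderiv D (fun s => c s *: w s) t
    (l *: w t + c t *: k).
Proof.
move=> dc dw phi; rewrite linearD !linearZ; under eq_fun do rewrite linearZ.
exact: (has_derivM dc (dw phi)).
Qed.

Lemma has_vderiv_sum D (J : Type) (r : seq J) (w : J -> R -> W) (l : J -> W) t :
  (forall j, has_vderiv D (w j) t (l j)) ->
  has_vderiv D (fun s => \sum_(j <- r) w j s) t (\sum_(j <- r) l j).
Proof.
move=> dw phi; rewrite linear_sum; under eq_fun do rewrite linear_sum.
by apply: has_deriv_sum => j; exact: dw.
Qed.

Lemma vsmooth_sumZ D (J : Type) (r : seq J) (c : J -> R -> R) (w : J -> R -> W)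
  :
  (forall j, smooth_on D (c j)) -> (forall j, vsmooth_on D (w j)) ->
  vsmooth_on D (fun s => \sum_(j <- r) c j s *: w j s).
Proof.
move=> sc sw phi; under eq_fun do rewrite linear_sum.
apply: smooth_sum => j; under eq_fun do rewrite linearZ.
by apply: smoothM; [exact: sc|exact: sw].
Qed.

Lemma has_vderiv_linear D (A : 'End(W)) w t l : has_vderiv D w t l ->
  has_vderiv D (fun s => A (w s)) t (A l).
Proof. by move=> dw phi; exact: (dw (phi \o A)). Qed.

Variable sigma : {skew_symmetric W}.

Let sigmaE (u v : W) : sigma u v = \sum_a \sum_b
  crd a u * crd b v * sigma (bas a) (bas b).
Proof.
rewrite {1}(crdE u) sigma_suml; apply: eq_bigr => a _.
rewrite sigmaZl {1}(crdE v) sigma_sumr mulr_sumr; apply: eq_bigr => b _.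
by rewrite sigmaZr mulrA.
Qed.

Lemma has_deriv_sigma D u v t l k : has_vderiv D u t l -> has_vderiv D v t k ->
  has_deriv D (fun s => sigma (u s) (v s)) t (sigma l (v t) + sigma (u t) k).
Proof.
move=> du dv.
have -> : sigma l (v t) + sigma (u t) k = \sum_a \sum_b
    sigma (bas a) (bas b) *
    (crd a l * crd b (v t) + crd a (u t) * crd b k).
  rewrite !sigmaE -big_split; apply: eq_bigr => a _ /=.
  by rewrite -big_split; apply: eq_bigr => b _ /=; ring.
have -> : (fun s => sigma (u s) (v s)) = (fun s => \sum_a \sum_b
    sigma (bas a) (bas b) * (crd a (u s) * crd b (v s))).
  apply/funext => s; rewrite sigmaE; apply: eq_bigr => a _.
  by apply: eq_bigr => b _; rewrite mulrC.
apply: has_deriv_sum => a; apply: has_deriv_sum => b; apply: has_derivZ.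
by apply: has_derivM; [exact: du|exact: dv].
Qed.

Lemma smooth_sigma D u v : vsmooth_on D u -> vsmooth_on D v ->
  smooth_on D (fun s => sigma (u s) (v s)).
Proof.
move=> su sv; under eq_fun do rewrite sigmaE.
apply: smooth_sum => a; apply: smooth_sum => b.
by apply: smoothM; [apply: smoothM; [exact: su|exact: sv]|exact: smooth_cst].
Qed.

End VectorDerivative.

(** * Linear differential systems with vector unknowns *)

Section VectorODE.
Variables (R : realType) (W : vectType R) (T : finType) (A : T -> T -> R -> R).
Variable I : set R.
Hypotheses (iI : is_interval I) (nI : exists a b, [/\ I a, I b & a < b]).
Hypothesis sA : forall i j, smooth_on I (A i j).

Definition vode_solution (X : T -> R -> W) :=
  forall p t, I t -> has_vderiv I (X p) t (\sum_q A p q t *: X q t).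

Lemma vode_solution_form X (phi : {scalar W}) : vode_solution X ->
  ode_solution A I (fun p t => phi (X p t)).
Proof.
move=> dX p t It; have := dX p t It phi; rewrite linear_sum.
by under eq_bigr do rewrite linearZ.
Qed.

Arguments vode_solution_form : clear implicits.

Lemma vode_solution_smooth X p : vode_solution X -> vsmooth_on I (X p).
Proof.
by move=> dX phi; exact: (ode_solution_smooth sA (vode_solution_form _ phi dX)
  p).
Qed.

(** Linear forms turn a vector solution into a scalar one, and separate the
    vectors. *)
Lemma vode_unique X Y t0 : I t0 -> vode_solution X -> vode_solution Y ->
  (forall p, X p t0 = Y p t0) -> forall p t, I t -> X p t = Y p t.
Proof.
move=> It0 dX dY XY0 p t It.
rewrite (coord_vbasis (memvf (X p t))) (coord_vbasis (memvf (Y p t))).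
apply: eq_bigr => a _; congr (_ *: _); apply/eqP; rewrite -subr_eq0; apply/eqP.
apply: (ode_unique iI nI (fun i j => smooth_continuous (sA i j))
  (x := fun p t => coord (vbasis fullv) a (X p t) - coord (vbasis fullv) a
    (Y p t))
  It0) => // [q s Is|q]; last by rewrite XY0 subrr.
have := has_derivB (vode_solution_form _ (coord (vbasis fullv) a) dX q s Is)
  (vode_solution_form _ (coord (vbasis fullv) a) dY q s Is).
by rewrite -sumrB; under eq_bigr do rewrite -mulrBr.
Qed.

Lemma vode_exists (x0 : T -> W) t0 : I t0 ->
  exists2 X, vode_solution X & forall p, X p t0 = x0 p.
Proof.
move=> It0.
have /choice[g gP] : forall a : 'I_(\dim {:W}), exists g, ode_solution A I g /\
    forall p, g p t0 = coord (vbasis fullv) a (x0 p).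
  move=> a.
  have [g dg g0] := ode_exists iI nI (fun i j => smooth_continuous (sA i j))
    (fun p => coord (vbasis fullv) a (x0 p)) It0.
  by exists g.
exists (fun p t => \sum_a g a p t *: (vbasis {:W})`_a) => [p t It|p];
  last first.
  rewrite [RHS](coord_vbasis (memvf _)); apply: eq_bigr => a _.
  by have [_ ->] := gP a.
have -> : \sum_q A p q t *: (\sum_a g a q t *: (vbasis {:W})`_a) =
    \sum_a ((\sum_q A p q t * g a q t) *: (vbasis {:W})`_a + g a p t *: 0).
  under eq_bigr do rewrite scaler_sumr; rewrite exchange_big /=.
  apply: eq_bigr => a _; rewrite scaler0 addr0 scaler_suml.
  by apply: eq_bigr => q _; rewrite scalerA.
apply: has_vderiv_sum => a; apply: has_vderivZ; last exact: has_vderiv_cst.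
by have [dg _] := gP a; exact: dg.
Qed.

End VectorODE.

(** * The structure equations of a normal frame *)

Section StructureEquations.
Variables (R : realType) (W : vectType R).
Variable sigma : {skew_symmetric W}.
Variables (m : nat) (I : set R) (b : bool).
Implicit Types (E F : 'I_m -> R -> W) (lam : 'I_m -> R -> R).

Definition structure_equations E F lam t :=
  [/\ (forall i j : 'I_m, j = i.+1 :> nat ->
         has_vderiv I (E i) t (E j t)),
      (forall i : 'I_m, i.+1 = m ->
         has_vderiv I (E i) t ((-1) ^+ b *: F i t)),
      (forall i : 'I_m, i = 0%N :> nat ->
         has_vderiv I (F i) t (lam (rev_ord i) t *: E i t)) &
      (forall i j : 'I_m, i = j.+1 :> nat ->
         has_vderiv I (F i) t (lam (rev_ord i) t *: E i t - F j t))].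

(** The structure equations form a linear system for the [2 * m] vectors of the
    frame, indexed here by ['I_m + 'I_m]. *)
Definition frame_family E F (p : 'I_m + 'I_m) : R -> W :=
  match p with inl i => E i | inr i => F i end.

Definition structure_matrix lam (p q : 'I_m + 'I_m) (t : R) : R :=
  match p, q with
  | inl i, inl k => (k == i.+1 :> nat)%:R
  | inl i, inr k => (-1) ^+ b * ((i == k) && (i.+1 == m))%:R
  | inr i, inl k => lam (rev_ord i) t * (i == k)%:R
  | inr i, inr k => - (i == k.+1 :> nat)%:R
  end.

Lemma smooth_structure_matrix lam p q : (forall i, smooth_on I (lam i)) ->
  smooth_on I (structure_matrix lam p q).
Proof.
move=> slam; case: p => i; case: q => k; try exact: smooth_cst.
by apply: smoothM; [exact: slam|exact: smooth_cst].
Qed.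

Lemma sum_deltaZ (J : finType) (c : J -> W) i : \sum_j (i == j)%:R *: c j = c i.
Proof.
rewrite (bigD1 i) //= eqxx scale1r big1 ?addr0 // => j /negPf ji.
by rewrite eq_sym ji scale0r.
Qed.

Section Sums.
Variables (E F : 'I_m -> R -> W) (lam : 'I_m -> R -> R) (t : R).

Let S p := \sum_q structure_matrix lam p q t *: frame_family E F q t.

Let S_E_next (i j : 'I_m) : j = i.+1 :> nat -> S (inl i) = E j t.
Proof.
move=> ji; rewrite /S big_sumType /= [X in _ + X]big1 ?addr0; last first.
  move=> k _; have /negPf -> : i.+1 != m by rewrite -ji neq_ltn ltn_ord.
  by rewrite andbF mulr0 scale0r.
by rewrite -[RHS](sum_deltaZ (E^~ t)); apply: eq_bigr => k _;
  rewrite -ji eq_sym.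
Qed.

Let S_E_last (i : 'I_m) : i.+1 = m -> S (inl i) = (-1) ^+ b *: F i t.
Proof.
move=> im; rewrite /S big_sumType /= big1 ?add0r; last first.
  by move=> k _; rewrite im ltn_eqF ?scale0r.
rewrite -[F i t](sum_deltaZ (F^~ t)) scaler_sumr; apply: eq_bigr => k _.
by rewrite im eqxx andbT scalerA.
Qed.

Let S_F_first (i : 'I_m) : i = 0%N :> nat ->
  S (inr i) = lam (rev_ord i) t *: E i t.
Proof.
move=> i0; rewrite /S big_sumType /= [X in _ + X]big1 ?addr0; last first.
  by move=> k _; rewrite i0 oppr0 scale0r.
rewrite -[E i t](sum_deltaZ (E^~ t)) scaler_sumr; apply: eq_bigr => k _.
by rewrite scalerA.
Qed.

Let S_F_next (i j : 'I_m) : i = j.+1 :> nat ->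
  S (inr i) = lam (rev_ord i) t *: E i t - F j t.
Proof.
move=> ij; rewrite /S big_sumType /=; congr (_ + _).
  rewrite -[E i t](sum_deltaZ (E^~ t)) scaler_sumr; apply: eq_bigr => k _.
  by rewrite scalerA.
rewrite -[F j t](sum_deltaZ (F^~ t)) -sumrN; apply: eq_bigr => k _.
by rewrite scaleNr ij eqSS.
Qed.

Lemma structure_equationsP : structure_equations E F lam t <->
  forall p, has_vderiv I (frame_family E F p) t (S p).
Proof.
split=> [[h1 h2 h3 h4] [i|i]|H].
- have [im|/eqP im] := eqVneq i.+1 m; first by rewrite S_E_last //; exact: h2.
  have lt : (i.+1 < m)%N by rewrite ltn_neqAle ltn_ord andbT; exact/eqP.
  by rewrite (@S_E_next i (Ordinal lt)) //; exact: h1.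
- case i0 : (nat_of_ord i) => [|k]; first by rewrite S_F_first //; exact: h3.
  have lt : (k < m)%N by rewrite (leq_trans _ (ltn_ord i)) // i0 ltnW.
  by rewrite (@S_F_next i (Ordinal lt)) //; exact: h4.
- split=> [i j ij|i im|i i0|i j ij].
  + by rewrite -(S_E_next ij); exact: (H (inl i)).
  + by rewrite -(S_E_last im); exact: (H (inl i)).
  + by rewrite -(S_F_first i0); exact: (H (inr i)).
  + by rewrite -(S_F_next ij); exact: (H (inr i)).
Qed.

End Sums.

Definition darboux_gram (p q : 'I_m + 'I_m) : R :=
  match p, q with
  | inl i, inr k => - (i == k)%:R
  | inr i, inl k => (i == k)%:R
  | _, _ => 0
  end.

Lemma symplectic_family_gram (E F : 'I_m -> W) :
  symplectic_family sigma E F <-> forall p q : 'I_m + 'I_m,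
  sigma (match p with inl i => E i | inr i => F i end)
        (match q with inl i => E i | inr i => F i end) = darboux_gram p q.
Proof.
split=> [[EE FF FE] [i|i] [k|k] //=|H].
  by rewrite sigmaC FE eq_sym.
by split=> i k; [exact: (H (inl i) (inl k))|exact: (H (inr i) (inr k))|
  exact: (H (inr i) (inl k))].
Qed.

Lemma sum_deltaM (J : finType) (c : J -> R) i : \sum_j (i == j)%:R * c j = c i.
Proof.
rewrite (bigD1 i) //= eqxx mul1r big1 ?addr0 // => j /negPf ji.
by rewrite eq_sym ji mul0r.
Qed.

(** With [M] the structure matrix and [J] the Darboux Gram matrix, this is
    [M * J + J * M^T = 0]: [J] is a stationary solution of the equation that
    governs the Gram matrix of a solution. *)
Lemma structure_matrix_symplectic lam p q t :
  \sum_r structure_matrix lam p r t * darboux_gram r q +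
  \sum_r structure_matrix lam q r t * darboux_gram p r = 0.
Proof.
have L (J : finType) (c : J -> R) k : \sum_j c j * (j == k)%:R = c k.
  by under eq_bigr do rewrite mulrC eq_sym; exact: sum_deltaM.
have L' (J : finType) (c : J -> R) k : \sum_j c j * (k == j)%:R = c k.
  by under eq_bigr do rewrite mulrC; exact: sum_deltaM.
have Z (J : finType) (c : J -> R) : \sum_j c j * 0 = 0.
  by rewrite big1 // => j _; rewrite mulr0.
have N (J : finType) (c d : J -> R) : \sum_j c j * - d j = - \sum_j c j * d j.
  by rewrite -sumrN; apply: eq_bigr => j _; rewrite mulrN.
case: p => i; case: q => k; rewrite !big_sumType /= ?Z ?N ?L ?L' ?addr0 ?add0r.
- rewrite [i == k]eq_sym; case: eqP => [->|_]; first by rewrite subrr.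
  by rewrite mulr0 subrr.
- by rewrite subrr.
- by rewrite addrC subrr.
- rewrite [k == i]eq_sym; case: eqP => [->|_];
  last by rewrite !mulr0 oppr0 addr0.
  by rewrite addrC subrr.
Qed.

Hypotheses (iI : is_interval I) (nI : exists a b, [/\ I a, I b & a < b]).

(** The Gram matrix of a solution satisfies a linear system of which the
    Darboux Gram matrix is a solution; they agree at [t0], hence everywhere. *)
Lemma structure_equations_symplectic E F lam t0 t :
  (forall i, smooth_on I (lam i)) -> I t0 -> I t ->
  (forall s, I s -> structure_equations E F lam s) ->
  symplectic_family sigma (E^~ t0) (F^~ t0) ->
  symplectic_family sigma (E^~ t) (F^~ t).
Proof.
move=> slam It0 It st /symplectic_family_gram H0; apply/symplectic_family_gram.
pose M := structure_matrix lam; pose X := frame_family E F.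
pose B (u v : ('I_m + 'I_m) * ('I_m + 'I_m)) s :=
  M u.1 v.1 s * (u.2 == v.2)%:R + M u.2 v.2 s * (u.1 == v.1)%:R.
have cB u v : {within I, continuous (B u v)}.
  apply: smooth_continuous; apply: smoothD; apply: smoothM;
    by [exact: smooth_structure_matrix|exact: smooth_cst].
pose h (u : ('I_m + 'I_m) * ('I_m + 'I_m)) s :=
  sigma (X u.1 s) (X u.2 s) - darboux_gram u.1 u.2.
suff : forall u s, I s -> h u s = 0.
  move=> h0 p q; have := h0 (p, q) t It => /eqP; rewrite subr_eq0 => /eqP /=.
  by case: p => i; case: q => k.
apply: (ode_unique iI nI cB It0) => [[p q] s Is|[p q]]; last first.
  apply/eqP; rewrite subr_eq0; apply/eqP; have := H0 p q.
  by case: p => i; case: q => k.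
have dX r : has_vderiv I (X r) s (\sum_r' M r r' s *: X r' s).
  by have /structure_equationsP := st s Is; apply.
have := has_derivB (has_deriv_sigma (sigma := sigma) (dX p) (dX q))
  (has_deriv_cst I (darboux_gram p q) s).
congr has_deriv; rewrite subr0 sigma_suml sigma_sumr.
under eq_bigr do rewrite sigmaZl.
under [X in _ + X = _]eq_bigr do rewrite sigmaZr.
rewrite -(pair_bigA _ (fun r r' => B (p, q) (r, r') s * h (r, r') s)) /=.
have -> : \sum_r \sum_r' B (p, q) (r, r') s * h (r, r') s =
    \sum_r M p r s * h (r, q) s + \sum_r M q r s * h (p, r) s.
  under eq_bigr do under eq_bigr do rewrite mulrDl.
  under eq_bigr do rewrite big_split.
  rewrite big_split /=; congr (_ + _).
    apply: eq_bigr => r _; under eq_bigr do rewrite mulrAC mulrC.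
    by rewrite sum_deltaM.
  rewrite exchange_big; apply: eq_bigr => r _.
  by under eq_bigr do rewrite mulrAC mulrC; rewrite sum_deltaM.
rewrite /h /=; under [in RHS]eq_bigr do rewrite mulrBr.
under [X in _ = _ + X]eq_bigr do rewrite mulrBr.
rewrite !sumrB addrACA -opprD structure_matrix_symplectic subr0.
by [].
Qed.

Lemma structure_equations_solution E F lam :
  (forall t, I t -> structure_equations E F lam t) ->
  vode_solution (structure_matrix lam) I (frame_family E F).
Proof. by move=> st p t It; have /structure_equationsP := st t It; apply. Qed.

Lemma structure_equations_exist (E0 F0 : 'I_m -> W) lam t0 : I t0 ->
  (forall i, smooth_on I (lam i)) -> exists E F,
  [/\ forall i, E i t0 = E0 i, forall i, F i t0 = F0 i,
      (forall i, vsmooth_on I (E i)) /\ (forall i, vsmooth_on I (F i)) &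
      forall t, I t -> structure_equations E F lam t].
Proof.
move=> It0 slam; have sM p q := smooth_structure_matrix p q slam.
have [X dX X0] := vode_exists iI nI sM
  (fun p => match p with inl i => E0 i | inr i => F0 i end) It0.
exists (fun i => X (inl i)), (fun i => X (inr i)); split.
- by move=> i; rewrite X0.
- by move=> i; rewrite X0.
- by split => i; exact: (vode_solution_smooth sM _ dX).
move=> t It; apply/structure_equationsP => p; have := dX p t It.
set S := \sum_q _; set S' := \sum_q _.
have -> : S = S' by apply: eq_bigr => -[k|k].
by case: p @S @S'.
Qed.

End StructureEquations.

(** * Leading terms along a chain of derivatives *)

Section ChainAsymptotics.
Variables (R : realType) (I : set R) (t0 : R).
Hypotheses (iI : is_interval I) (It0 : I t0).
Variables (N : nat) (eps : nat -> R) (k : nat -> nat) (c z : nat -> R -> R).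
Hypothesis dz : forall l t, (l < N)%N -> I t ->
  has_deriv I (z l) t (eps l * z l.+1 t + c l t * z (k l) t).
Hypothesis kl : forall l, (l < N)%N -> (k l <= l)%N.
Hypothesis cc : forall l, (l < N)%N ->
  c l t @[t --> within I t0^'] --> c l t0.
Hypothesis z0 : forall l, (l < N)%N -> z l t0 = 0.
Hypothesis zN : z N t @[t --> within I t0^'] --> z N t0.

Let lhopital_step n l (x y : R) : (l < N)%N ->
  z l.+1 t / (t - t0) ^+ n @[t --> within I t0^'] --> x ->
  z (k l) t / (t - t0) ^+ n @[t --> within I t0^'] --> y ->
  z l t / (t - t0) ^+ n.+1 @[t --> within I t0^'] -->
    (eps l * x + c l t0 * y) / n.+1%:R.
Proof.
move=> ltlN Hx Hy.
apply: (has_deriv_lhopital iI It0 (z0 ltlN) (fun t => dz ltlN)).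
have : eps l * (z l.+1 t / (t - t0) ^+ n) + c l t * (z (k l) t / (t - t0) ^+ n)
    @[t --> within I t0^'] --> eps l * x + c l t0 * y.
  apply: cvgD; apply: cvgM => //; first exact: cvg_cst.
  exact: cc.
apply: cvg_trans; apply: near_eq_cvg; apply/near_dnbhsP; exists 1 => // s _ _ _.
by rewrite mulrDl !mulrA.
Qed.

Let chain_little_o n l : (n + l < N)%N ->
  z l t / (t - t0) ^+ n @[t --> within I t0^'] --> (0 : R).
Proof.
elim: n l => [|n IH] l lt.
  have := has_deriv_cvg (dz lt It0); rewrite (z0 lt).
  apply: cvg_trans; apply: near_eq_cvg; apply/near_dnbhsP;
    exists 1 => // s _ _ _.
  by rewrite expr0 divr1.
have ltlN : (l < N)%N by lia.
have := lhopital_step ltlN (IH l.+1 _) (IH (k l) _); rewrite !mulr0 addr0 mul0r.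
by apply; have := kl ltlN; lia.
Qed.

(** The feedback terms [c l * z (k l)] are of higher order than the forward
    terms [eps l * z l.+1], so the leading behaviour is that of the iterated
    integrals of a constant. *)
Lemma chain_asymptotics l : (l <= N)%N ->
  z l t / (t - t0) ^+ (N - l) @[t --> within I t0^'] -->
    (\prod_(l <= i < N) eps i) * z N t0 / (N - l)`!%:R.
Proof.
move=> lelN; have [d dE] : exists d, (N - l)%N = d by exists (N - l)%N.
rewrite dE; elim: d l lelN dE => [|d IH] l lelN dE.
  have -> : l = N by lia.
  rewrite big_geq // mul1r fact0 divr1; apply: cvg_trans zN; apply: near_eq_cvg.
  by apply/near_dnbhsP; exists 1 => // s _ _ _; rewrite expr0 divr1.
have ltlN : (l < N)%N by lia.
have klN := kl ltlN.
have dE' : (N - l.+1)%N = d by lia.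
have lt : (d + k l < N)%N by lia.
have -> : \prod_(l <= i < N) eps i * z N t0 / d.+1`!%:R =
    (eps l * (\prod_(l.+1 <= i < N) eps i * z N t0 / d`!%:R) + c l t0 * 0) /
    d.+1%:R.
  by rewrite mulr0 addr0 [in LHS]big_ltn // factS mulnC natrM invfM !mulrA.
exact: (lhopital_step ltlN (IH l.+1 ltlN dE') (chain_little_o lt)).
Qed.

End ChainAsymptotics.

(** Multiplying column [j] by [(2 * m - 1 - j)!] turns the entries into falling
    factorials, that is, into the values at [m] distinct points of polynomials
    of degrees [0, ..., m - 1]. *)
Lemma det_inv_factorial_neq0 (R : realType) m :
  \det (\matrix_(i < m, j < m) ((2 * m - 1 - j - i)`!%:R)^-1 : 'M[R]_m) != 0.
Proof.
apply/det0P => -[v v0 vA].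
pose ff i : {poly R} := \prod_(k < i) ('X - (k%:R)%:P).
have ffE i n : (ff i).[n%:R] = (n ^_ i)%:R.
  rewrite horner_prod ffact_prod natr_prod.
  case: (leqP i n) => [lein|ltni].
    by apply: eq_bigr => k _; rewrite hornerXsubC natrB // ltnW //
      (leq_trans _ lein).
  rewrite (bigD1 (Ordinal ltni)) //= hornerXsubC subrr mul0r.
  by rewrite (bigD1 (Ordinal ltni)) //= subnn mul0r.
have ff_size i : size (ff i) = i.+1.
  by rewrite size_prod_XsubC /index_enum -enumT size_enum_ord.
pose g := \sum_(i < m) v 0 i *: ff i.
have gE (n : nat) : g.[n%:R] = \sum_(i < m) v 0 i * (n ^_ i)%:R.
  by rewrite horner_sum; apply: eq_bigr => i _; rewrite hornerZ ffE.
have fact_neq0 n : n`!%:R != 0 :> R by rewrite pnatr_eq0 -lt0n fact_gt0.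
have groot (j : 'I_m) : root g (2 * m - 1 - j)%N%:R.
  apply/rootP; rewrite gE; set n := (2 * m - 1 - j)%N.
  have := congr1 (fun A : 'rV_m => n`!%:R * A 0 j) vA.
  rewrite !mxE mulr0 mulr_sumr => E; rewrite -[RHS]E.
  apply: eq_bigr => i _; rewrite mxE -/n mulrCA; congr (_ * _).
  have lein : (i <= n)%N by rewrite /n; have := ltn_ord i; have := ltn_ord j;
    lia.
  by rewrite -(ffact_fact lein) natrM mulfK.
have g0 : g = 0.
  apply/eqP/negPn/negP => g0.
  pose rs := [seq (2 * m - 1 - j)%N%:R | j : 'I_m] : seq R.
  have rs_root : all (root g) rs.
    by apply/allP => _ /mapP[j _ ->]; exact: groot.
  have rs_uniq : uniq rs.
    rewrite map_inj_uniq ?enum_uniq // => i j /eqP; rewrite eqr_nat => /eqP E.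
    by apply: val_inj => /=; have := ltn_ord i; have := ltn_ord j; lia.
  have szg : (size g <= m)%N.
    apply: (leq_trans (size_sum _ _ _)); apply/bigmax_leqP => i _.
    by apply: (leq_trans (size_scale_leq _ _)); rewrite ff_size.
  have := max_poly_roots g0 rs_root rs_uniq.
  by rewrite size_image card_ord ltnNge szg.
case/negP: v0; apply/eqP/rowP => i; rewrite mxE.
have [n] := ubnP (nat_of_ord i); elim: n i => // n IH i ltin.
have := gE i; rewrite g0 horner0 (bigD1 i) //= big1 ?addr0.
  move=> /eqP; rewrite eq_sym mulf_eq0 pnatr_eq0 ffactnn.
  by rewrite eqn0Ngt fact_gt0 orbF => /eqP.
move=> j ji; have [ltji|ltij] : (j < i)%N \/ (i < j)%N.
  by move: ji; rewrite -(inj_eq val_inj) /= neq_ltn => /orP.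
- by rewrite IH ?mul0r //; lia.
- by rewrite ffact_small // mulr0.
Qed.

(** * The velocity of a framed curve *)

Section FrameGeometry.
Variables (R : realType) (W : vectType R).
Variable sigma : {skew_symmetric W}.
Variables (I : set R).
Hypotheses (iI : is_interval I) (nI : exists a b, [/\ I a, I b & a < b]).

(** A normal frame in which the sign [b] of the velocity is a parameter: for a
    curve spanned by such a frame, [b] is the sign of its velocity. *)
Definition structured_frame m b L (E F : 'I_m -> R -> W) lam :=
  [/\ (forall i, vsmooth_on I (E i)) /\ (forall i, vsmooth_on I (F i)),
      (forall t, I t -> darboux sigma (E ^~ t) (F ^~ t)),
      (forall t, I t -> L t = <<codom (E ^~ t)>>%VS) &
      forall t, I t -> structure_equations I b E F lam t].

Lemma normal_frameE m L (E F : 'I_m -> R -> W) lam :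
  normal_frame sigma I L E F lam <->
  exists b, velocity_sign sigma b I L /\ structured_frame b L E F lam.
Proof.
split=> [[sEF dEF LE [b vb st]]|[b [vb [sEF dEF LE st]]]].
  by exists b.
by split => //; exists b.
Qed.

Variables (n : nat) (b : bool) (L : R -> {vspace W}).
Variables (E F : 'I_n.+1 -> R -> W) (lam : 'I_n.+1 -> R -> R).
Hypothesis fr : structured_frame b L E F lam.

Let limit_point t : I t -> ProperFilter (within I t^').
Proof. exact: interval_limit_point. Qed.

Let smoothE i : vsmooth_on I (E i).
Proof. by have [[]] := fr. Qed.

Let smoothF i : vsmooth_on I (F i).
Proof. by have [[]] := fr. Qed.

Let frame_darboux t : I t -> darboux sigma (E ^~ t) (F ^~ t).
Proof. by have [_ + _ _] := fr; apply. Qed.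

Lemma frame_memP t w : I t -> w \in L t <-> forall i, sigma w (E i t) = 0.
Proof.
move=> It; have [_ _ LE _] := fr; rewrite LE //.
exact: darboux_mem_span (frame_darboux It).
Qed.

Lemma frame_mem_comb t w : I t ->
  w \in L t <-> exists c : 'I_n.+1 -> R, w = \sum_i c i *: E i t.
Proof. by move=> It; have [_ _ LE _] := fr; rewrite LE //;
  exact: mem_span_codom. Qed.

Lemma frame_mem t i : I t -> E i t \in L t.
Proof. by move=> It; apply/frame_memP => // j;
  have [_ EE _ _] := frame_darboux It. Qed.

Lemma frame_expand t w : I t -> w \in L t ->
  w = \sum_i sigma (F i t) w *: E i t.
Proof.
move=> It /(frame_memP w It) wE.
rewrite [LHS](darboux_expand w (frame_darboux It)) [X in _ + X]big1 ?addr0 //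
  => i _.
by rewrite wE scale0r.
Qed.

Lemma frame_isotropic t u v : I t -> u \in L t -> v \in L t -> sigma u v = 0.
Proof.
move=> It /(frame_memP u It) uE vL; rewrite (frame_expand It vL) sigma_sumr.
by rewrite big1 // => i _; rewrite sigmaZr uE mulr0.
Qed.

Lemma frame_lagrangian t : I t -> lagrangian n.+1 sigma (L t).
Proof.
move=> It; split; last by move=> u v; exact: frame_isotropic.
have := symplectic_family_free (darboux_family (frame_darboux It)).
rewrite cat_free => /and3P[fE _ _]; have [_ _ LE _] := fr.
by rewrite LE //; move: fE; rewrite /free => /eqP ->;
  rewrite size_codom card_ord.
Qed.

(** Only [E ord_max] leaves [L] to first order, in the direction of
    [F ord_max]. *)
Lemma frame_derivative t i : I t -> exists2 v, has_vderiv I (E i) t v &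
  forall l, l \in L t ->
    sigma v l = (i == ord_max)%:R * ((-1) ^+ b * sigma (F ord_max t) l).
Proof.
move=> It; have [_ _ _ /(_ t It)[dE dEl _ _]] := fr.
have [->|iM] := eqVneq i ord_max.
  exists ((-1) ^+ b *: F ord_max t); first exact: dEl.
  by move=> l _; rewrite mul1r sigmaZl.
have lt : (i.+1 < n.+1)%N.
  by have := ltn_ord i; move: iM; rewrite -(inj_eq val_inj) /=; lia.
exists (E (Ordinal lt) t); first exact: dE.
by move=> l lL; rewrite mul0r (frame_isotropic It) //; exact: frame_mem.
Qed.

(** Write a curve in [L] as [\sum_i a i *: E i] with smooth coefficients. In
    its derivative only [a ord_max] times the derivative of [E ord_max] is not
    in [L]. *)
Lemma frame_velocity t l : I t -> l \in L t ->
  velocity sigma I L t l = (-1) ^+ b * sigma (F ord_max t) l ^+ 2.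
Proof.
move=> It lL.
have /choice[dE dEP] : forall i, exists v, has_vderiv I (E i) t v /\
    forall l, l \in L t ->
    sigma v l = (i == ord_max)%:R * ((-1) ^+ b * sigma (F ord_max t) l).
  by move=> i; have [v dv vl] := frame_derivative i It; exists v.
pose a i := sigma (F i t) l.
(* [L t] is isotropic: pairing with [l] only sees the part leaving [L t] *)
have value (c : 'I_n.+1 -> R) :
    sigma (\sum_i (c i *: E i t + a i *: dE i)) l =
    (-1) ^+ b * sigma (F ord_max t) l ^+ 2.
  rewrite sigma_suml (bigD1 ord_max) //= big1 => [|i iM].
    rewrite addr0 sigmaDl !sigmaZl (frame_isotropic It (frame_mem _ It) lL)
      mulr0 add0r.
    have [_ ->] := dEP ord_max => //; rewrite eqxx mul1r /a.
    by rewrite expr2 mulrCA.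
  rewrite sigmaDl !sigmaZl (frame_isotropic It (frame_mem _ It) lL) mulr0 add0r.
  by have [_ ->] := dEP i; rewrite // (negPf iM) mul0r mulr0.
apply: xget_unique => /=.
  exists (fun s => \sum_i cst (a i) s *: E i s),
         (\sum_i (0 *: E i t + a i *: dE i)); split.
  - by apply: vsmooth_sumZ => // i; exact: smooth_cst.
  - by move=> s Is; apply/frame_mem_comb => //; exists a.
  - by rewrite [RHS](frame_expand It lL).
  - apply: has_vderiv_sum => i; apply: has_vderivZ; first exact: has_deriv_cst.
    by have [] := dEP i.
  - by rewrite value.
move=> _ [w [w' [sw wL wt dw ->]]].
have /choice[c' dc] : forall i, exists l,
    has_deriv I (fun s => sigma (F i s) (w s)) t l.
  move=> i; have [g _ dg] := smooth_has_deriv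
    (smooth_sigma sigma (smoothF i) sw).
  by exists (g t); exact: dg.
have dw' : has_vderiv I w t (\sum_i (c' i *: E i t + a i *: dE i)).
  apply: (@has_vderiv_ext _ _ _ (fun s => \sum_i sigma (F i s) (w s) *: E i s))
    => //.
    by move=> s Is; rewrite [RHS](frame_expand Is (wL s Is)).
  apply: has_vderiv_sum => i; rewrite /a -wt.
  by apply: has_vderivZ; [exact: dc|have [] := dEP i].
by rewrite (has_vderiv_unique (limit_point It) dw dw') value.
Qed.

Lemma frame_velocity_last t : I t ->
  velocity sigma I L t (E ord_max t) = (-1) ^+ b.
Proof.
move=> It; rewrite frame_velocity //; last exact: frame_mem.
by have [_ _ _ ->] := frame_darboux It; rewrite eqxx expr1n mulr1.
Qed.

Lemma frame_velocity_sign : velocity_sign sigma b I L.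
Proof.
move=> t l It lL; rewrite frame_velocity // mulrA -exprD addnn -signr_odd
  odd_double.
by rewrite expr0 mul1r sqr_ge0.
Qed.

(** The sign is visible on [E ord_max], where the velocity is [(-1) ^+ b]. *)
Lemma frame_velocity_signE b' : velocity_sign sigma b' I L -> b' = b.
Proof.
have [t [_ [It _ _]]] := nI.
move=> /(_ t (E ord_max t) It (frame_mem _ It)); rewrite frame_velocity_last //.
by case: b'; case: b => //=; rewrite ?expr1 ?expr0; lra.
Qed.

(** The velocity is plus or minus the square of a nonzero linear form. *)
Lemma frame_rank1 t : I t -> qf_rank (L t) (velocity sigma I L t) = 1%N.
Proof.
move=> It; pose f := sigma (F ord_max t).
pose e (i : 'I_(\dim (L t))) := (vbasis (L t))`_i.
have eL i : e i \in L t by apply: vbasis_mem; apply: mem_nth;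
  rewrite size_tuple.
pose r : 'rV[R]_(\dim (L t)) := \row_i f (e i).
have polarE : (\matrix_(i, j) polar (velocity sigma I L t) (e i) (e j)) =
    ((-1) ^+ b *: r^T) *m r.
  apply/matrixP => i j; rewrite !mxE big_ord1 !mxE /polar.
  by rewrite !frame_velocity ?memvD // sigmaDr -/f; field.
have [i fi] : exists i, f (e i) != 0.
  apply/not_existsP => H.
  have : f (E ord_max t) = 0.
    rewrite (coord_vbasis (frame_mem ord_max It)) /f sigma_sumr big1 // => i _.
    rewrite sigmaZr; have /negP/negPn/eqP := H i; rewrite /f /e => ->.
    by rewrite mulr0.
  rewrite /f; have [_ _ _ ->] := frame_darboux It.
  by rewrite eqxx => /eqP; rewrite oner_eq0.
rewrite /qf_rank polarE; apply/eqP; rewrite eqn_leq.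
rewrite (leq_trans (mulmx_max_rank _ _)) //= lt0n mxrank_eq0.
apply/eqP => /matrixP/(_ i i); rewrite !mxE big_ord1 !mxE => /eqP.
by rewrite -mulrA mulf_eq0 signr_eq0 /= mulf_eq0 orbb (negPf fi).
Qed.

End FrameGeometry.

(** * Charts and the weight of a framed curve *)

Section MatrixLimits.
Variable R : realType.

Lemma cvg_det (T : Type) (G : set_system T) (FG : Filter G) m
    (A : T -> 'M[R]_m) (B : 'M[R]_m) :
  (forall i j, A t i j @[t --> G] --> B i j) -> \det (A t) @[t --> G] -->
    \det B.
Proof.
move=> AB; apply: cvg_big => [|s _]; first exact: add_continuous.
apply: cvgM; first exact: cvg_cst.
by apply: cvg_big => [|i _]; [exact: mul_continuous|exact: AB].
Qed.

Lemma cvg_within_subset (D D' : set R) (t0 l : R) (f : R -> R) : D' `<=` D ->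
  f t @[t --> within D t0^'] --> l -> f t @[t --> within D' t0^'] --> l.
Proof.
move=> sub; apply: cvg_trans; apply: cvg_app => P.
move=> /near_dnbhsP[d d0 H]; apply/near_dnbhsP; exists d => // s /sub; exact: H.
Qed.

End MatrixLimits.

Section FrameChart.
Variables (R : realType) (W : vectType R).
Variable sigma : {skew_symmetric W}.
Variables (I : set R).
Hypotheses (iI : is_interval I) (nI : exists a b, [/\ I a, I b & a < b]).
Variables (n : nat) (b : bool) (L : R -> {vspace W}).
Variables (E F : 'I_n.+1 -> R -> W) (lam : 'I_n.+1 -> R -> R).
Hypothesis fr : structured_frame sigma I b L E F lam.
Hypothesis slam : forall i, smooth_on I (lam i).
Variables (t0 : R) (It0 : I t0).

Let smoothE i : vsmooth_on I (E i).
Proof. by have [[]] := fr. Qed.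

Let frame_darboux t : I t -> darboux sigma (E ^~ t) (F ^~ t).
Proof. by have [_ + _ _] := fr; apply. Qed.

Let vsmooth_cst (w : W) : vsmooth_on I (cst w).
Proof. by move=> phi; exact: (smooth_cst I (phi w)).
Qed.

(** The components of the frame at [t] in the frame at [t0]: the curve is the
    graph of [(Q t)^T * ((P t)^T)^-1] as long as [P t] is invertible. *)
Let P t : 'M[R]_n.+1 := \matrix_(i, k) sigma (F k t0) (E i t).
Let Q t : 'M[R]_n.+1 := \matrix_(i, k) sigma (E i t) (E k t0).
Definition frame_chart t : 'M[R]_n.+1 := (Q t)^T *m invmx (P t)^T.
Let S := frame_chart.

Let smoothP i k : smooth_on I (fun t => P t i k).
Proof.
under eq_fun do rewrite mxE.
exact: (smooth_sigma sigma (vsmooth_cst (F k t0)) (smoothE i)).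
Qed.

Let smoothQ i k : smooth_on I (fun t => Q t i k).
Proof.
under eq_fun do rewrite mxE.
exact: (smooth_sigma sigma (smoothE i) (vsmooth_cst (E k t0))).
Qed.

Let P_t0 : P t0 = 1%:M.
Proof.
apply/matrixP => i k; rewrite !mxE; have [_ _ _ ->] := frame_darboux It0.
by rewrite eq_sym.
Qed.

Let Q_t0 : Q t0 = 0.
Proof. by apply/matrixP => i k; rewrite !mxE;
  have [_ -> _ _] := frame_darboux It0. Qed.

Let frame_coordsE t i :
  E i t = \sum_k P t i k *: E k t0 + \sum_k Q t i k *: F k t0.
Proof.
rewrite [LHS](darboux_expand _ (frame_darboux It0)).
by congr (_ + _); apply: eq_bigr => k _; rewrite mxE.
Qed.

Let of_coords_comb t (c : 'cV[R]_n.+1) :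
  of_coords (E ^~ t0) (F ^~ t0) ((P t)^T *m c) ((Q t)^T *m c) =
  \sum_i c i 0 *: E i t.
Proof.
have -> : \sum_i c i 0 *: E i t = \sum_i (\sum_k (c i 0 * P t i k) *: E k t0 +
    \sum_k (c i 0 * Q t i k) *: F k t0).
  apply: eq_bigr => i _; rewrite frame_coordsE scalerDr !scaler_sumr.
  by congr (_ + _); apply: eq_bigr => k _; rewrite scalerA.
rewrite big_split /= /of_coords; congr (_ + _); rewrite [RHS]exchange_big;
  apply: eq_bigr => k _; rewrite mxE scaler_suml; apply: eq_bigr => i _;
  by rewrite [in LHS]mxE mulrC.
Qed.

Lemma frame_chart_mem t w : I t -> \det (P t) != 0 ->
  w \in L t <-> exists x, w = of_coords (E ^~ t0) (F ^~ t0) x (S t *m x).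
Proof.
move=> It d0; have uP : (P t)^T \in unitmx by rewrite unitmx_tr unitmxE unitfE.
rewrite (frame_mem_comb fr) //; split=> [[c ->]|[x ->]].
  exists ((P t)^T *m \col_i c i); rewrite /S /frame_chart mulmxA mulmxKV //.
  by rewrite of_coords_comb; apply: eq_bigr => i _; rewrite mxE.
exists (fun i => (invmx (P t)^T *m x) i 0).
by rewrite -of_coords_comb mulKVmx // /S /frame_chart -mulmxA.
Qed.

(** The span of the [E i t] is isotropic exactly when [Q P^T] is symmetric. *)
Lemma frame_chart_sym t : I t -> \det (P t) != 0 -> (S t)^T = S t.
Proof.
move=> It d0; have uP : P t \in unitmx by rewrite unitmxE unitfE.
have PQ : Q t *m (P t)^T = P t *m (Q t)^T.
  apply/matrixP => i j; have [_ EE _ _] := frame_darboux It.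
  have := EE i j; rewrite [in X in sigma _ X]frame_coordsE sigmaDr !sigma_sumr
    => /eqP.
  rewrite addr_eq0 => /eqP E1; rewrite !mxE.
  transitivity (\sum_k sigma (E i t) (P t j k *: E k t0)).
    by apply: eq_bigr => k _; rewrite sigmaZr !mxE mulrC.
  rewrite E1 -sumrN; apply: eq_bigr => k _.
  by rewrite sigmaZr -mulrN -sigmaC !mxE mulrC.
rewrite /S /frame_chart trmx_mul trmx_inv !trmxK.
have -> : (Q t)^T *m invmx (P t)^T = invmx (P t) *m (P t *m (Q t)^T) *m invmx
  (P t)^T.
  by rewrite mulKmx.
by rewrite -PQ -!mulmxA mulmxV ?unitmx_tr // mulmx1.
Qed.

Let det_P_neq0 : exists2 e, 0 < e &
  forall t, I t -> `|t - t0| < e -> \det (P t) != 0.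
Proof.
have /subspace_continuousP/(_ t0 It0)/cvgrPdist_lt/(_ 1 ltr01)/near_nbhsP :=
  smooth_continuous (smooth_det smoothP).
rewrite /from_subspace P_t0 det1 => -[e e0 H]; exists e => // t It te.
by apply: contraTneq (H t It te) => ->; rewrite subr0 normr1 ltxx.
Qed.

Lemma frame_chart_in_chart : in_chart sigma I L t0 (E ^~ t0) (F ^~ t0) S.
Proof.
split; first exact: frame_darboux.
  have := symplectic_family_free (darboux_family (frame_darboux It0)).
  rewrite cat_free => /and3P[_ _ /directv_addP]; have [_ _ LE _] := fr.
  by rewrite LE.
have [e e0 d0] := det_P_neq0.
apply/near_nbhsP; exists e => // t It te; split.
  by apply: frame_chart_sym => //; exact: d0.
by move=> w; apply: frame_chart_mem => //; exact: d0.
Qed.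

Lemma frame_chart_smooth : exists2 e : R, 0 < e &
  forall i j, smooth_on (I `&` ball t0 e) (fun t => S t i j).
Proof.
have [e e0 d0] := det_P_neq0; exists e => // i j.
have sub : I `&` ball t0 e `<=` I by move=> s [].
apply: smooth_mulmx => k l.
  by under eq_fun do rewrite mxE; exact: (smooth_subset sub (smoothQ l k)).
apply: smooth_invmx => [k' l'|t [It]].
  by under eq_fun do rewrite mxE; exact: (smooth_subset sub (smoothP l' k')).
by rewrite det_tr -ball_normE /= distrC; exact: d0.
Qed.

(** The frame is listed as the chain [E 0, ..., E n, F n, ..., F 0]: up to sign
    and up to a multiple of an earlier vector, each vector is the derivative of
    the one before. *)
Let Z (l : nat) : R -> W :=
  if (l <= n)%N then E (inord l) else F (inord (2 * n + 1 - l)).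
Let eps (l : nat) : R := if (l < n)%N then 1 else if l == n then (-1) ^+ b else
  -1.
Let c (l : nat) (t : R) : R :=
  if (l <= n)%N then 0 else lam (rev_ord (inord (2 * n + 1 - l))) t.
Let k (l : nat) : nat := if (l <= n)%N then l else (2 * n + 1 - l)%N.

Let chain_derivative l t : (l < 2 * n + 1)%N -> I t ->
  has_vderiv I (Z l) t (eps l *: Z l.+1 t + c l t *: Z (k l) t).
Proof.
move=> lt It; have [_ _ _ /(_ t It)[dE dEl dF0 dF]] := fr.
rewrite /Z /eps /c /k; case: (ltngtP l n) => [ltln|ltnl|->].
- rewrite scale1r scale0r addr0; apply: dE.
  by rewrite !inordK // ltnS // ltnW.
- have -> : (2 * n + 1 - l <= n)%N by lia.
  rewrite scaleN1r addrC; apply: dF.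
  by rewrite !inordK ?ltnS; lia.
- rewrite scale0r addr0; have -> : (2 * n + 1 - n.+1)%N = n by lia.
  by apply: dEl; rewrite inordK.
Qed.

(** The pairing with [E j t0] vanishes at [t0] on the chain until it reaches
    [F j], which is [2 * n + 1 - j - i] derivatives away from [E i]. *)
Let Q_asymptotics (i j : 'I_n.+1) :
  Q t i j / (t - t0) ^+ (2 * n.+1 - 1 - j - i) @[t --> within I t0^'] -->
  (\prod_(n <= l < 2 * n + 1 - j) eps l) / (2 * n.+1 - 1 - j - i)`!%:R.
Proof.
pose z l t := sigma (Z l t) (E j t0); pose N := (2 * n + 1 - j)%N.
have [ltj lti] := (ltn_ord j, ltn_ord i).
have dz l t : (l < N)%N -> I t ->
    has_deriv I (z l) t (eps l * z l.+1 t + c l t * z (k l) t).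
  move=> lt It; have lt' : (l < 2 * n + 1)%N by rewrite /N in lt; lia.
  have := has_deriv_sigma (sigma := sigma) (chain_derivative lt' It)
    (has_vderiv_cst I (E j t0) t).
  by rewrite sigma0r addr0 sigmaDl !sigmaZl.
have kl l : (l < N)%N -> (k l <= l)%N by rewrite /k; case: ifP => //; lia.
have cc l : (l < N)%N -> c l t @[t --> within I t0^'] --> c l t0.
  move=> _; apply: continuous_cvg_dnbhs => //; apply: smooth_continuous.
  by rewrite /c; case: (l <= n)%N; [exact: (smooth_cst I 0)|exact: slam].
have [_ EE _ FE] := frame_darboux It0.
have z0 l : (l < N)%N -> z l t0 = 0.
  rewrite /z /Z /N => lt; case: ifP => [_|ln]; first exact: EE.
  rewrite FE -(inj_eq val_inj) /= inordK; last by lia.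
  by have /negPf -> : (2 * n + 1 - l)%N != j by lia.
have ZN : Z N = F j.
  rewrite /Z /N; have -> : (2 * n + 1 - j <= n)%N = false by lia.
  by congr F; apply: val_inj; rewrite /= inordK; lia.
have zN1 : z N t0 = 1 by rewrite /z ZN FE eqxx.
have zN : z N t @[t --> within I t0^'] --> z N t0.
  apply: continuous_cvg_dnbhs => //; apply: smooth_continuous.
  apply: (smooth_sigma sigma); last exact: vsmooth_cst.
  by rewrite ZN; have [[_ sF] _ _ _] := fr; exact: sF.
have leiN : (i <= N)%N by rewrite /N; lia.
have := chain_asymptotics iI It0 dz kl cc z0 zN leiN.
rewrite zN1 mulr1 /N; have -> : (2 * n + 1 - j - i = 2 * n.+1 - 1 - j - i)%N by
  lia.
have -> : \prod_(i <= l < 2 * n + 1 - j) eps l = \prod_(n <= l < 2 * n + 1 - j)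
  eps l.
  rewrite (@big_cat_nat _ _ _ n) /=; [|by lia|by lia].
  rewrite big_nat_cond big1 ?mul1r // => l; rewrite andbT => /andP[_ ltln].
  by rewrite /eps ltln.
apply: cvg_trans; apply: near_eq_cvg; apply/near_dnbhsP; exists 1 => // s _ _ _.
by rewrite /z /Z mxE -ltnS lti inord_val.
Qed.

(** Entry [(i, j)] of [Q t] has order
    [2 * n + 1 - j - i = (n.+1 - i) + (n - j)], so powers of [t - t0] factor
    out of its rows and columns; the sum [K] of their exponents is
    [n.+1 ^ 2]. *)
Let K := (\sum_(i < n.+1) (n.+1 - i) + \sum_(j < n.+1) (n - j))%N.

Let det_Q_asymptotics : exists2 d, d != 0 &
  \det (Q t) / (t - t0) ^+ K @[t --> within I t0^'] --> d.
Proof.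
pose e (j : 'I_n.+1) := \prod_(n <= l < 2 * n + 1 - j) eps l.
pose Fa : 'M[R]_n.+1 := \matrix_(i, j) ((2 * n.+1 - 1 - j - i)`!%:R)^-1.
pose Q' t : 'M[R]_n.+1 := \matrix_(i, j)
  (Q t i j / (t - t0) ^+ (2 * n.+1 - 1 - j - i)).
exists (\det (Fa *m diag_mx (\row_j e j))).
  rewrite det_mulmx mulf_neq0 ?det_inv_factorial_neq0 // det_diag.
  apply/prodf_neq0 => j _; rewrite mxE /e prodf_seq_neq0; apply/allP => l _ /=.
  rewrite /eps; case: ifP => _; first exact: oner_neq0.
  by case: ifP => _; rewrite ?signr_eq0 // oppr_eq0 oner_eq0.
have : \det (Q' t) @[t --> within I t0^'] --> \det (Fa *m diag_mx (\row_j e j)).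
  apply: cvg_det => i j; rewrite mul_mx_diag !mxE mulrC.
  have := @Q_asymptotics i j; apply: cvg_trans; apply: near_eq_cvg.
  by apply/near_dnbhsP; exists 1 => // s _ _ _; rewrite !mxE.
apply: cvg_trans; apply: near_eq_cvg; apply/near_dnbhsP;
  exists 1 => // s _ _ st.
have st0 : s - t0 != 0 by rewrite subr_eq0.
have -> : Q s = diag_mx (\row_i (s - t0) ^+ (n.+1 - i)) *m Q' s *m
    diag_mx (\row_j (s - t0) ^+ (n - j)).
  apply/matrixP => i j; rewrite mul_mx_diag mul_diag_mx; rewrite !mxE.
  have -> : (2 * n.+1 - 1 - j - i = (n.+1 - i) + (n - j))%N.
    by have [? ?] := (ltn_ord i, ltn_ord j); lia.
  by rewrite exprD; field; rewrite !expf_neq0.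
have prE (a : 'I_n.+1 -> nat) : \det (diag_mx (\row_i (s - t0) ^+ a i)) =
    (s - t0) ^+ (\sum_i a i).
  by rewrite det_diag expr_sum; apply: eq_bigr => i _; rewrite mxE.
rewrite !det_mulmx !prE /K exprD; field; by rewrite !expf_neq0.
Qed.

(** As [det (P t)] tends to [1], the determinant of the chart vanishes to the
    same order as that of [Q t], which is the same at every point of [I]. *)
Lemma frame_weight : weight n.+1 sigma I L t0 K.
Proof.
exists (E ^~ t0), (F ^~ t0), S; split; first exact: frame_chart_in_chart.
have [e e0 sS] := frame_chart_smooth; exists e => //.
have S_t0 : S t0 = 0 by rewrite /S /frame_chart Q_t0 trmx0 mul0mx.
pose f t := \det (S t - S t0).
have [G dG] : smooth_on (I `&` ball t0 e) f.
  apply: (smooth_ext (f := fun t => \det (S t))); last exact: smooth_det.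
  by move=> t _; rewrite /f S_t0 subr0.
exists G; have [d d0 Qd] := det_Q_asymptotics.
have sub : I `&` ball t0 e `<=` I by move=> s [].
have fd : f t / (t - t0) ^+ K @[t --> within (I `&` ball t0 e) t0^'] --> d.
  apply: (cvg_within_subset sub).
  have cP : \det (P t) @[t --> within I t0^'] --> (1 : R).
    rewrite -(det1 R n.+1) -P_t0; apply: continuous_cvg_dnbhs => //.
    exact: smooth_continuous (smooth_det smoothP).
  have : \det (Q t) / (t - t0) ^+ K * (\det (P t))^-1 @[t --> within I t0^'] -->
      d * 1^-1.
    by apply: cvgM => //; apply: cvgV => //; exact: oner_neq0.
  rewrite invr1 mulr1; apply: cvg_trans; apply: near_eq_cvg.
  apply/near_dnbhsP; exists 1 => // s _ _ _.
  by rewrite /f S_t0 subr0 /S /frame_chart det_mulmx det_inv !det_tr mulrAC.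
have D0 : (I `&` ball t0 e) t0 by split => //; exact: ballxx.
have iD : is_interval (I `&` ball t0 e).
  move=> x y [Ix bx] [Iy By] z xyz; split; first exact: iI xyz.
  move: bx By xyz; rewrite !ball_itv /= !in_itv /= =>
    /andP[h1 h2] /andP[h3 h4] /andP[h5 h6].
  by apply/andP; split; [exact: lt_le_trans h5|exact: le_lt_trans h4].
have PD : ProperFilter (within (I `&` ball t0 e) t0^').
  split; last exact: within_filter.
  move=> /near_dnbhsP[r r0 H].
  have [+ _] := interval_limit_point iI nI It0; apply.
  apply/near_dnbhsP; exists (Num.min r e); first by rewrite lt_min r0.
  move=> s Is; rewrite lt_min => /andP[sr se]; apply: H => //.
  by split => //; rewrite -ball_normE /= distrC.
have [G0 GK] := derivatives_zero_order iD PD D0 dG fd d0.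
by split.
Qed.

End FrameChart.

(** * Uniqueness of the normal frame *)

Section FrameUniqueness.
Variables (R : realType) (W : vectType R).
Variable sigma : {skew_symmetric W}.
Variables (I : set R).
Hypotheses (iI : is_interval I) (nI : exists a b, [/\ I a, I b & a < b]).
Variables (n : nat) (b : bool) (L : R -> {vspace W}).
Variables (E F E' F' : 'I_n.+1 -> R -> W) (lam lam' : 'I_n.+1 -> R -> R).
Hypothesis fr : structured_frame sigma I b L E F lam.
Hypothesis fr' : structured_frame sigma I b L E' F' lam'.

Let limit_point t : I t -> ProperFilter (within I t^').
Proof. exact: interval_limit_point. Qed.

Let st t : I t -> structure_equations I b E F lam t.
Proof. by have [_ _ _] := fr; apply. Qed.

Let st' t : I t -> structure_equations I b E' F' lam' t.
Proof. by have [_ _ _] := fr'; apply. Qed.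

Let dx t : I t -> darboux sigma (E ^~ t) (F ^~ t).
Proof. by have [_ + _ _] := fr; apply. Qed.

Let dx' t : I t -> darboux sigma (E' ^~ t) (F' ^~ t).
Proof. by have [_ + _ _] := fr'; apply. Qed.

Let isoE i k t : I t -> sigma (E i t) (E' k t) = 0.
Proof.
move=> It; apply: (frame_isotropic fr It); first exact: (frame_mem fr).
exact: (frame_mem fr').
Qed.

Let deriv_of_zero (f : R -> R) l t : (forall s, I s -> f s = 0) -> I t ->
  has_deriv I f t l -> l = 0.
Proof.
move=> f0 It df; apply: has_deriv_unique (limit_point It) df _.
by apply: (has_deriv_ext (f := cst 0)) => //;
  [move=> s /f0 ->|exact: has_deriv_cst].
Qed.

(* the coefficients of the second frame in the first: [a k i] is the component
   of [E' k] along [E i] *)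
Let a k i t := sigma (F i t) (E' k t).

Let expand k t : I t -> E' k t = \sum_i a k i t *: E i t.
Proof. by move=> It; exact: (frame_expand fr It (frame_mem fr' k It)). Qed.

Let a_deriv (k k1 i i1 : 'I_n.+1) t : k1 = k.+1 :> nat -> i1 = i.+1 :> nat ->
  I t -> has_deriv I (a k i1) t (a k1 i1 t - a k i t).
Proof.
move=> kk1 ii1 It; have [_ _ _ /(_ i1 i ii1) dF] := st It.
have [/(_ k k1 kk1) dE' _ _ _] := st' It.
have := has_deriv_sigma (sigma := sigma) dF dE'; congr has_deriv.
rewrite sigmaDl sigmaZl isoE // mulr0 add0r addrC.
by rewrite -[- F i t]scaleN1r sigmaZl mulN1r.
Qed.

(** For [k < n] the derivative [E' k.+1] of [E' k] stays in [L], so [E' k] has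
    no component along [E n], the only vector that leaves [L]; going down from
    [n], differentiating [a k i.+1 = 0] gives [a k i = a k.+1 i.+1 = 0]. *)
Let a_triangular (i k : 'I_n.+1) t : (k < i)%N -> I t -> a k i t = 0.
Proof.
have [d] : exists d, (i + d)%N = n.
  by exists (n - i)%N; have := ltn_ord i; lia.
elim: d i k t => [|d IH] i k t idn ltki It.
  have iM : i.+1 = n.+1 by lia.
  have lt : (k.+1 < n.+1)%N by lia.
  have [/(_ k (Ordinal lt) erefl) dE' _ _ _] := st' It.
  have [_ /(_ i iM) dE _ _] := st It.
  have := deriv_of_zero _ It (has_deriv_sigma (sigma := sigma) dE dE').
  rewrite isoE // addr0 sigmaZl => H.
  have /eqP := H (fun s Is => isoE i k Is).
  by rewrite mulf_eq0 signr_eq0 => /eqP.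
have lti : (i.+1 < n.+1)%N by lia.
have ltk : (k.+1 < n.+1)%N by lia.
have := deriv_of_zero _ It (@a_deriv k (Ordinal ltk) i (Ordinal lti) t erefl
  erefl It).
rewrite (IH (Ordinal lti) (Ordinal ltk)) //=; last by lia.
rewrite sub0r => H; apply/eqP; rewrite -oppr_eq0; apply/eqP; apply: H => s Is.
by apply: IH => //=; lia.
Qed.

(* the common diagonal coefficient, which turns out to be the sign relating the
   two frames *)
Let al := a ord0 ord0.

Let a_diag (k : 'I_n.+1) t : I t -> a k k t = al t.
Proof.
move=> It; have [j kj] : exists j, nat_of_ord k = j by exists k.
elim: j k kj => [|j IH] k kj; first by rewrite /al; congr a; apply: val_inj.
have ltj : (j < n.+1)%N by have := ltn_ord k; lia.
have := deriv_of_zero _ It (@a_deriv (Ordinal ltj) k (Ordinal ltj) k t kj kj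
  It).
rewrite (IH (Ordinal ltj)) // => H; apply/eqP; rewrite -subr_eq0; apply/eqP.
by apply: H => s Is; apply: a_triangular; rewrite //= kj.
Qed.

(** Both [E ord_max] and [E' ord_max] have velocity [(-1) ^+ b]. *)
Let al_sqr t : I t -> al t ^+ 2 = 1.
Proof.
move=> It; have := frame_velocity_last iI nI fr' It.
rewrite (frame_velocity iI nI fr It) ?(frame_mem fr') //.
rewrite -/(a ord_max ord_max t) a_diag // => /eqP.
by rewrite -subr_eq0 -[X in _ - X]mulr1 -mulrBr mulf_eq0 signr_eq0 /= subr_eq0
  => /eqP.
Qed.

Let al_neq0 t : I t -> al t != 0.
Proof.
by move=> /al_sqr E2; apply: contra_eq_neq E2 => ->;
  rewrite expr0n eq_sym oner_neq0.
Qed.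

Let al_deriv t : I t -> has_deriv I al t 0.
Proof.
move=> It; have [[_ sF] _ _ _] := fr; have [[sE' _] _ _ _] := fr'.
have [g _ dg] := smooth_has_deriv (smooth_sigma sigma (sF ord0) (sE' ord0)).
have dal := dg t It; rewrite -/al in dal.
have d1 := has_derivB (has_derivM dal dal) (has_deriv_cst I 1 t).
have /eqP : g t * al t + al t * g t - 0 = 0.
  by apply: deriv_of_zero It d1 => s Is; rewrite /= -expr2 al_sqr ?subrr.
rewrite subr0 [al t * _]mulrC -mulr2n mulrn_eq0 /= mulf_eq0.
by rewrite (negPf (al_neq0 It)) orbF => /eqP <-.
Qed.

Let E'E (k : 'I_n.+1) t : I t -> E' k t = al t *: E k t.
Proof.
have [j kj] : exists j, nat_of_ord k = j by exists k.
elim: j k t kj => [|j IH] k t kj It.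
  have -> : k = ord0 by exact: val_inj.
  rewrite [LHS]expand // (bigD1 ord0) //= big1 ?addr0 // => i i0.
  by rewrite a_triangular ?scale0r //= lt0n.
have ltj : (j < n.+1)%N by have := ltn_ord k; lia.
have [/(_ (Ordinal ltj) k kj) dE' _ _ _] := st' It.
have [/(_ (Ordinal ltj) k kj) dE _ _ _] := st It.
apply: (has_vderiv_unique (limit_point It) dE').
have := has_vderivZ (al_deriv It) dE; rewrite scale0r add0r.
by apply: has_vderiv_ext => // s Is; rewrite (IH (Ordinal ltj)).
Qed.

Let F'_last t : I t -> F' ord_max t = al t *: F ord_max t.
Proof.
move=> It; have [_ /(_ ord_max erefl) dE' _ _] := st' It.
have [_ /(_ ord_max erefl) dE _ _] := st It.
have := has_vderivZ (al_deriv It) dE; rewrite scale0r add0r => dE2.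
have : (-1) ^+ b *: F' ord_max t = al t *: ((-1) ^+ b *: F ord_max t).
  apply: (has_vderiv_unique (limit_point It) dE').
  by apply: has_vderiv_ext dE2 => // s Is; rewrite E'E.
by rewrite scalerA mulrC -scalerA; apply: scalerI; rewrite signr_eq0.
Qed.

(** Comparing the derivatives of [F' i] and [al *: F i], and pairing the result
    with [F' i], isolates the curvatures. *)
Let F'_down (i j : 'I_n.+1) t : i = j.+1 :> nat -> I t ->
  (forall s, I s -> F' i s = al s *: F i s) ->
  lam' (rev_ord i) t = lam (rev_ord i) t /\ F' j t = al t *: F j t.
Proof.
move=> ij It F'i; have [_ _ _ /(_ i j ij) dF] := st It.
have [_ _ _ /(_ i j ij) dF'] := st' It.
have := has_vderivZ (al_deriv It) dF; rewrite scale0r add0r => dF2.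
have H : lam' (rev_ord i) t *: E' i t - F' j t =
    al t *: (lam (rev_ord i) t *: E i t - F j t).
  apply: (has_vderiv_unique (limit_point It) dF').
  by apply: has_vderiv_ext dF2 => // s Is; rewrite F'i.
have [_ _ FF FE] := dx It; have [_ _ FF' FE'] := dx' It.
have lamE : lam' (rev_ord i) t = lam (rev_ord i) t.
  have := congr1 (sigma (F' i t)) H.
  rewrite linearBr /= sigmaZr FE' FF' eqxx mulr1 subr0 => ->.
  rewrite F'i // sigmaZl sigmaZr linearBr /= sigmaZr FE FF eqxx mulr1 subr0
    mulrA.
  by rewrite -expr2 al_sqr // mul1r.
split => //; move: H; rewrite lamE E'E // scalerBr scalerA mulrC -scalerA.
by move=> /addrI /oppr_inj.
Qed.

(** The second frame is [al] times the first with [al = 1] or [al = -1] at each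
    point; descending from [F ord_max] to [F ord0] then identifies the
    curvatures one by one. *)
Lemma structured_frame_curvature i t : I t -> lam' i t = lam i t.
Proof.
have F'F : forall d (i : 'I_n.+1) s, (i + d)%N = n -> I s ->
  F' i s = al s *: F i s.
  elim=> [|d IH] {}i s idn Is.
    have -> : i = ord_max by apply: val_inj => /=; lia.
    exact: F'_last.
  have lti : (i.+1 < n.+1)%N by lia.
  have [] // := @F'_down (Ordinal lti) i s erefl Is.
  by move=> u Iu; apply: IH => //=; lia.
have {}F'F (j : 'I_n.+1) s : I s -> F' j s = al s *: F j s.
  by apply: (F'F (n - j)%N); have := ltn_ord j; lia.
move=> It; rewrite -(rev_ordK i); set j := rev_ord i.
case j0 : (nat_of_ord j) => [|k].
  have [_ _ /(_ j j0) dF _] := st It; have [_ _ /(_ j j0) dF' _] := st' It.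
  have := has_vderivZ (al_deriv It) dF; rewrite scale0r add0r => dF2.
  have H : lam' (rev_ord j) t *: E' j t = al t *: (lam (rev_ord j) t *: E j t).
    apply: (has_vderiv_unique (limit_point It) dF').
    by apply: has_vderiv_ext dF2 => // s Is; rewrite F'F.
  have [_ _ _ FE] := dx It.
  have /(mulIf (al_neq0 It)) : lam' (rev_ord j) t * al t = lam (rev_ord j) t *
    al t.
    have := congr1 (sigma (F j t)) H.
    by rewrite E'E // !sigmaZr FE eqxx !mulr1 [al t * _]mulrC.
  by [].
have ltk : (k < n.+1)%N by have := ltn_ord j; lia.
by have [] := @F'_down j (Ordinal ltk) t j0 It (F'F j).
Qed.

End FrameUniqueness.

(** * Symplectic maps between Darboux bases *)

Section DarbouxMap.
Variables (R : realType) (W : vectType R) (m : nat).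
Variable sigma : {skew_symmetric W}.

(** The linear map carrying the Darboux basis [(E, F)] to [(E', F')], with the
    coordinates expressed by [sigma]. *)
Definition darboux_map (E F E' F' : 'I_m -> W) (w : W) : W :=
  \sum_i sigma (F i) w *: E' i + \sum_i sigma w (E i) *: F' i.

Lemma darboux_map_linear E F E' F' : linear (darboux_map E F E' F').
Proof.
move=> c u v; rewrite /darboux_map scalerDr !scaler_sumr addrACA.
rewrite -[X in _ = X + _]big_split -[X in _ = _ + X]big_split /=.
congr (_ + _); apply: eq_bigr => i _; rewrite scalerA -scalerDl.
  by rewrite sigmaDr sigmaZr.
by rewrite sigmaDl sigmaZl.
Qed.

HB.instance Definition _ E F E' F' :=
  GRing.isLinear.Build R W W _ (darboux_map E F E' F')
    (@darboux_map_linear E F E' F').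

Lemma darboux_sigma (E F : 'I_m -> W) u v : darboux sigma E F ->
  sigma u v = \sum_i (sigma u (E i) * sigma (F i) v - sigma (F i) u * sigma v
    (E i)).
Proof.
move=> dEF; rewrite {1}(darboux_expand v dEF) sigmaDr !sigma_sumr -big_split /=.
apply: eq_bigr => i _; rewrite !sigmaZr [sigma u (F i)]sigmaC.
by rewrite mulrN mulrC [X in _ - X]mulrC.
Qed.

Lemma darboux_map_isometry (E F E' F' : 'I_m -> W) :
  darboux sigma E F -> darboux sigma E' F' ->
  isometry sigma sigma (linfun (darboux_map E F E' F')).
Proof.
move=> dEF dEF' u v; have EF' := darboux_family dEF'.
rewrite (darboux_sigma _ _ dEF') (darboux_sigma u v dEF); apply: eq_bigr => i _.
by rewrite !lfunE /= /darboux_map !(sigma_combl EF') !(sigma_combr EF').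
Qed.

Lemma darboux_mapE (E F E' F' : 'I_m -> W) i : darboux sigma E F ->
  darboux_map E F E' F' (E i) = E' i.
Proof.
move=> [_ EE _ FE]; rewrite /darboux_map [X in _ + X]big1 ?addr0; last first.
  by move=> k _; rewrite EE scale0r.
rewrite -[RHS](sum_deltaZ E'); apply: eq_bigr => k _.
by rewrite FE eq_sym.
Qed.

Lemma darboux_mapF (E F E' F' : 'I_m -> W) i : darboux sigma E F ->
  darboux_map E F E' F' (F i) = F' i.
Proof.
move=> [_ _ FF FE]; rewrite /darboux_map big1 ?add0r; last first.
  by move=> k _; rewrite FF scale0r.
by rewrite -[RHS](sum_deltaZ F'); apply: eq_bigr => k _; rewrite FE.
Qed.

End DarbouxMap.

(** * Reconstruction of a curve from its curvatures *)

Section Reconstruction.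
Variables (R : realType) (W : vectType R).
Variable sigma : {skew_symmetric W}.
Variables (I : set R).
Hypotheses (iI : is_interval I) (nI : exists a b, [/\ I a, I b & a < b]).
Variables (n : nat) (b : bool) (rho : 'I_n.+1 -> R -> R).
Hypothesis srho : forall i, smooth_on I (rho i).

Lemma structured_frame_exists : \dim {:W} = (2 * n.+1)%N ->
  nondegenerate sigma ->
  exists L E F, structured_frame sigma I b L E F rho.
Proof.
move=> dimW nd; have [t0 [_ [It0 _ _]]] := nI.
have [E0 [F0 dEF0]] := darboux_exists dimW nd.
have [E [F [E0E F0E sEF st]]] := structure_equations_exist b iI nI E0 F0 It0
  srho.
exists (fun t => <<codom (E ^~ t)>>%VS), E, F; split => // t It.
apply: symplectic_family_darboux => //.
apply: (structure_equations_symplectic iI nI srho It0 It st).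
have -> : E^~ t0 = E0 by apply/funext => i; rewrite E0E.
have -> : F^~ t0 = F0 by apply/funext => i; rewrite F0E.
exact: darboux_family.
Qed.

Lemma structured_frame_properties L E F : structured_frame sigma I b L E F rho
  ->
  [/\ rank1_curve n.+1 sigma I L,
      constant_finite_weight n.+1 sigma I L,
      velocity_sign sigma b I L &
      forall i, modified_curvature sigma I L i (rho i)].
Proof.
move=> fr; split.
- split; last by move=> t It; exact: (frame_rank1 iI nI fr).
  split; first by move=> t It; exact: (frame_lagrangian fr).
  move=> t0 It0; exists (E ^~ t0), (F ^~ t0), (frame_chart sigma E F t0); split.
    exact: (frame_chart_in_chart fr).
  exact: (frame_chart_smooth fr).
- by eexists => t It; exact: (frame_weight iI nI fr).
- exact: (frame_velocity_sign iI nI fr).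
move=> i; split.
  exists E, F, rho; apply/normal_frameE; exists b; split => //.
  exact: (frame_velocity_sign iI nI fr).
move=> E' F' lam' /normal_frameE[b' [vb' fr']] t It.
have bb' := frame_velocity_signE iI nI fr vb'; subst b'.
exact: (structured_frame_curvature iI nI fr fr').
Qed.

Lemma modified_curvature_frame L : velocity_sign sigma b I L ->
  (forall i, modified_curvature sigma I L i (rho i)) ->
  exists E F, structured_frame sigma I b L E F rho.
Proof.
move=> vb mc; have [[E [F [lam nf]]] _] := mc ord0.
have lamE i t : I t -> lam i t = rho i t by have [_ H] := mc i; exact: H nf t.
have /normal_frameE[b' [vb' [sEF dEF LE st]]] := nf.
have bb' := frame_velocity_signE iI nI (And4 sEF dEF LE st) vb; subst b'.
exists E, F; split => // t It; have [h1 h2 h3 h4] := st t It.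
by split => // [i i0|i j ij]; rewrite -lamE //; [exact: h3|exact: h4].
Qed.

(** The structure equations are linear, so the symplectic map matching the two
    frames at one point carries the first solution to a solution; by uniqueness
    it is the second one. *)
Lemma structured_frame_congruence L1 L2 E1 F1 E2 F2 :
  structured_frame sigma I b L1 E1 F1 rho ->
  structured_frame sigma I b L2 E2 F2 rho ->
  exists A : 'End(W), isometry sigma sigma A /\
    forall t, I t -> L2 t = (A @: L1 t)%VS.
Proof.
move=> [_ d1 L1E st1] [_ d2 L2E st2]; have [t0 [_ [It0 _ _]]] := nI.
pose A := linfun (darboux_map sigma (E1 ^~ t0) (F1 ^~ t0) (E2 ^~ t0)
  (F2 ^~ t0)).
exists A; split; first exact: (darboux_map_isometry (d1 _ It0) (d2 _ It0)).
have sM p q := smooth_structure_matrix b p q srho.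
have sol1 := structure_equations_solution st1.
have sol2 := structure_equations_solution st2.
have solA : vode_solution (structure_matrix b rho) I
    (fun p t => A (frame_family E1 F1 p t)).
  move=> p t It; have := has_vderiv_linear (A := A) (sol1 p t It).
  by rewrite linear_sum; under eq_bigr do rewrite linearZ.
have AX : forall p t, I t -> A (frame_family E1 F1 p t) = frame_family E2 F2 p
  t.
  apply: (vode_unique iI nI sM It0 solA sol2) => -[i|i]; rewrite lfunE /=.
    by rewrite darboux_mapE //; exact: d1.
  by rewrite darboux_mapF //; exact: d1.
move=> t It; rewrite L1E // L2E // limg_span; congr <<_>>%VS.
rewrite !codomE -[RHS]map_comp; apply: eq_map => i.
by rewrite /= (AX (inl i)).
Qed.

End Reconstruction.

Theorem theorem3 (R : realType) (m : nat) (W : vectType R)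
    (sigma : {skew_symmetric W}) (I : set R) (rho : 'I_m -> R -> R)
    (m_gt0 : (0 < m)%N)
    (dimW : \dim {:W} = (2 * m)%N)
    (symplectic_sigma : is_psymplectic sigma)
    (interval_I : is_interval I)
    (nondegenerate_I : exists a b, [/\ I a, I b & a < b])
    (smooth_rho : forall i, smooth_on I (rho i)) :
  forall b : bool,
    (exists L : R -> {vspace W},
       [/\ rank1_curve m sigma I L,
           constant_finite_weight m sigma I L,
           velocity_sign sigma b I L &
           forall i, modified_curvature sigma I L i (rho i)]) /\
    (forall L1 L2 : R -> {vspace W},
       [/\ rank1_curve m sigma I L1,
           constant_finite_weight m sigma I L1,
           velocity_sign sigma b I L1 &
           forall i, modified_curvature sigma I L1 i (rho i)] ->
       [/\ rank1_curve m sigma I L2,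
           constant_finite_weight m sigma I L2,
           velocity_sign sigma b I L2 &
           forall i, modified_curvature sigma I L2 i (rho i)] ->
       exists A : 'End(W), isometry sigma sigma A /\
         forall t, I t -> L2 t = (A @: L1 t)%VS).
Proof.
move=> b; case: m m_gt0 rho dimW smooth_rho => // n _ {}rho {}dimW {}smooth_rho.
have [nondeg _ _] := symplectic_sigma.
split.
  have [L [E [F frame]]] := structured_frame_exists interval_I nondegenerate_I b
    smooth_rho dimW nondeg.
  exists L; exact: (structured_frame_properties interval_I nondegenerate_I
    smooth_rho frame).
move=> L1 L2 [_ _ sign1 curv1] [_ _ sign2 curv2].
have [E1 [F1 frame1]] :=
  modified_curvature_frame interval_I nondegenerate_I sign1 curv1.
have [E2 [F2 frame2]] :=
  modified_curvature_frame interval_I nondegenerate_I sign2 curv2.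
exact: (structured_frame_congruence interval_I nondegenerate_I smooth_rho
  frame1 frame2).
Qed.
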